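(* Let $\rho\in V_0$ be dominant. Then: (a) For every $\lambda\in\Lambda_+$ there is a unique polynomial $p_\lambda\in\mathcal P^W$ with $\deg p_\lambda\le\ell(\lambda)$ and $p_\lambda(\rho+\mu)=\delta_{\lambda\mu}$ (Kronecker delta) for all $\mu\in\Lambda_+$ with $\ell(\mu)\le\ell(\lambda)$. (b) For every $d\in\mathbb N$, the set of $p_\lambda$ with $\lambda\in\Lambda_+$, $\ell(\lambda)\le d$, forms a basis of the space of $p\in\mathcal P^W$ with $\deg p\le d$. (c) The polynomial $p_\lambda$ is an eigenvector for $E$. More precisely, $E(p_\lambda)=\ell(\rho+\lambda)p_\lambda$.
   Context: Let $\Gamma$ be a lattice of finite rank, $\Sigma\subset\Gamma$ a $\mathbb Z$-basis, $W\subseteq\mathrm{Aut}(\Gamma)$ a finite group and $\ell\in\Gamma$. Put $V=\mathrm{Hom}(\Gamma,\mathbb C)$ with the induced $W$-action; elements of $\Gamma$ are regarded as linear functions on $V$. $\mathcal P=S^\bullet(\Gamma\otimes\mathbb C)$ is the algebra of polynomial functions on $V$, $\mathcal P^W$ its $W$-invariants. $\Gamma^\vee=\mathrm{Hom}(\Gamma,\mathbb Z)\subset V$, $\Sigma^\vee\subset\Gamma^\vee$ is the basis dual to $\Sigma$, and $\Lambda_+=\sum_{\eta\in\Sigma^\vee}\mathbb N\eta$ ($0\in\mathbb N$). Axioms (standing assumptions): (C1) $W$ is generated by reflections on $V$. [Thus there is a unique root system $\Delta\subset\Gamma$ with reflection group $W$ all of whose roots are primitive vectors of $\Gamma$; $\alpha^\vee\in\Gamma^\vee$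 denotes the coroot of $\alpha\in\Delta$. Put $\Delta^+=\{\alpha\in\Delta\mid\alpha(\eta)\ge0\ \forall\eta\in\Sigma^\vee\}$, $\Phi=W\Sigma$, $\Phi^+=\{\omega\in\Phi\mid\omega(\eta)\ge0\ \forall\eta\in\Sigma^\vee\}$, $\Sigma_1^\vee=\{\eta\in\Sigma^\vee\mid\ell(\eta)=1\}$.] (C2) $\Delta=\Delta^+\cup(-\Delta^+)$. (C3) $\Phi\subseteq\Phi^+\cup(-\Phi^+)$. (C4) $\ell\in\Gamma^W$. (C5) $\sum_{\omega\in\Phi^+}\omega-\sum_{\alpha\in\Delta^+}\alpha=\ell$. (C6) $\ell(\eta)>0$ for all $\eta\in\Sigma^\vee$. (C7) If $\eta\in\Sigma_1^\vee$ and $\omega\in\Delta\cup\Phi$ then $\omega(\eta)\in\{-1,0,1\}$. (C8) Any $W$-invariant linear function on $V$ is uniquely determined by its restriction to $\Sigma_1^\vee$. (C9) There is a regular dominant $\rho\in V_0$ such that for every $\lambda\in\Lambda_+$ there is a unique $p\in\mathcal P^W$ of degree $\ell(\lambda)$ with $p(\rho+\mu)=\delta_{\lambda\mu}$ for all $\mu\in\Lambda_+$ with $\ell(\mu)\le\ell(\lambda)$. Here $\pm W$ is the group generated by $W$ and $-1$, and $V_0=\{\rho\in V\mid \omega_1(\rho)=\omega_2(\rho)\text{ whenever }\omega_1,\omega_2\in\Sigma,\ \omega_1\in\pm W\omega_2\}$. An element $\rho$ is dominant if $\alpha(\rho)\notin\mathbb Z_{<0}$ for all $\alpha\in\Delta^+$,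 and regular if $\alpha(\rho)\ne0$ for all $\alpha\in\Delta^+$. For $\rho\in V_0$ and $\omega\in\Phi\cup(-\Phi)$ put $k_\omega=\omega_1(\rho)$ for any $\omega_1\in\pm W\omega\cap\Sigma$. Difference Euler operator (for given $\rho\in V_0$): $\Lambda_1=W\Sigma_1^\vee$; for $\eta\in\Lambda_1$, $f_\eta(z)=\prod_{\omega\in\Phi:\,\omega(\eta)>0}(\omega(z)-k_\omega)\Big/\prod_{\alpha\in\Delta:\,\alpha(\eta)>0}\alpha(z)$, a rational function on $V$; $(T_\eta f)(z)=f(z-\eta)$; $L=\sum_{\eta\in\Lambda_1}f_\eta(z)T_\eta$; $E=\ell-L$, where $\ell$ acts by multiplication. *)

(* Defs.v *)
From HB Require Import structures.
From mathcomp Require Import all_boot all_order all_algebra.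
From mathcomp Require Import finmap.
From mathcomp Require Import mpoly.

Set Implicit Arguments.
Unset Strict Implicit.
Unset Printing Implicit Defensive.

Import GRing.Theory Num.Theory.

Local Open Scope ring_scope.

Notation "x %:F" := (tofrac x) : ring_scope.

(* Conventions.  The lattice Gamma of rank n is Z^n, written as column vectors,
   so that Aut(Gamma) = GL_n(Z) acts by left multiplication.  Its dual
   Gamma^vee = Hom(Gamma, Z) and V = Hom(Gamma, C) are spaces of row vectors,
   with the contragredient (left) action.  The Z-basis Sigma is given by the
   columns of a matrix B invertible over Z; the dual basis Sigma^vee is then
   given by the rows of its inverse.  A polynomial p : {mpoly C[n]} is the
   polynomial function z |-> p.@[z 0] on V.  The base field is a parameter C. *)

Definition pairing n (g : 'cV[int]_n) (eta : 'rV[int]_n) : int :=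
  (eta *m g) 0 0.

Definition evalV (C : fieldType) n (g : 'cV[int]_n) (z : 'rV[C]_n) : C :=
  (z *m map_mx intr g) 0 0.

Definition inV (C : fieldType) n (eta : 'rV[int]_n) : 'rV[C]_n :=
  map_mx intr eta.

Definition act_dual n (w : 'M[int]_n) (eta : 'rV[int]_n) : 'rV[int]_n :=
  eta *m invmx w.

Definition actV_mx (C : fieldType) n (w : 'M[int]_n) : 'M[C]_n :=
  map_mx intr (invmx w).

Definition actV (C : fieldType) n (w : 'M[int]_n) (z : 'rV[C]_n) : 'rV[C]_n :=
  z *m actV_mx C w.

Definition Sigma n (B : 'M[int]_n) : {fset 'cV[int]_n} :=
  [fset col i B | i : 'I_n]%fset.

Definition Sigma_dual n (B : 'M[int]_n) : {fset 'rV[int]_n} :=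
  [fset row i (invmx B) | i : 'I_n]%fset.

Definition Lambda_plus n (B : 'M[int]_n) (lam : 'rV[int]_n) : Prop :=
  exists c : 'rV[int]_n -> nat, lam = \sum_(eta <- Sigma_dual B) eta *+ c eta.

Definition is_group n (W : {fset 'M[int]_n}) : Prop :=
  [/\ 1%:M \in W,
      forall v w, v \in W -> w \in W -> v *m w \in W,
      forall w, w \in W -> w \in unitmx
    & forall w, w \in W -> invmx w \in W].

(* For a finite group W, products of elements of S suffice: no inverses. *)
Definition generated_by n (W : {fset 'M[int]_n}) (S : 'M[int]_n -> Prop) :
    Prop :=
  (forall s, S s -> s \in W) /\
  (forall w, w \in W -> exists2 l : seq 'M[int]_n,
     (forall s, s \in l -> S s) & w = \big[mulmx/1%:M]_(s <- l) s).

Definition is_reflection (C : fieldType) n (s : 'M[int]_n) : Prop :=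
  actV_mx C s *m actV_mx C s = 1%:M /\ \rank (actV_mx C s - 1%:M) = 1%N.

Definition generated_by_reflections (C : fieldType) n (W : {fset 'M[int]_n}) :
    Prop :=
  generated_by W (fun s => s \in W /\ is_reflection C s).

Definition primitive n (a : 'cV[int]_n) : Prop :=
  forall (k : int) (b : 'cV[int]_n), a = k *: b -> `|k| = 1.

(* matrix of g |-> g - g(c) a *)
Definition refl_mx n (a : 'cV[int]_n) (c : 'rV[int]_n) : 'M[int]_n :=
  1%:M - a *m c.

(* Delta is a root system (not required to span) in Gamma with coroots in
   Gamma^vee, all of whose roots are primitive in Gamma, and W is its
   reflection group.  Primitivity forces the root system to be reduced. *)
Definition primitive_root_system n (W : {fset 'M[int]_n})
    (Delta : {fset 'cV[int]_n}) : Prop :=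
  exists coroot : 'cV[int]_n -> 'rV[int]_n,
    [/\ forall a, a \in Delta -> primitive a,
        forall a, a \in Delta -> pairing a (coroot a) = 2,
        forall a b, a \in Delta -> b \in Delta ->
          refl_mx a (coroot a) *m b \in Delta
      & generated_by W (fun s => exists2 a, a \in Delta &
                                   s = refl_mx a (coroot a))].

Definition nonneg_on_dual n (B : 'M[int]_n) (g : 'cV[int]_n) : bool :=
  all (fun eta => 0 <= pairing g eta) (Sigma_dual B).

Definition Delta_plus n (B : 'M[int]_n) (Delta : {fset 'cV[int]_n}) :
    {fset 'cV[int]_n} :=
  [fset a in Delta | nonneg_on_dual B a]%fset.

Definition Phi n (B : 'M[int]_n) (W : {fset 'M[int]_n}) : {fset 'cV[int]_n} :=
  [fset w *m g | w in W, g in Sigma B]%fset.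

Definition Phi_plus n (B : 'M[int]_n) (W : {fset 'M[int]_n}) :
    {fset 'cV[int]_n} :=
  [fset g in Phi B W | nonneg_on_dual B g]%fset.

Definition neg_set n (A : {fset 'cV[int]_n}) : {fset 'cV[int]_n} :=
  [fset - a | a in A]%fset.

Definition Sigma1_dual n (B : 'M[int]_n) (ell : 'cV[int]_n) :
    {fset 'rV[int]_n} :=
  [fset eta in Sigma_dual B | pairing ell eta == 1]%fset.

Definition axiomC2 n (B : 'M[int]_n) (Delta : {fset 'cV[int]_n}) : Prop :=
  Delta = (Delta_plus B Delta `|` neg_set (Delta_plus B Delta))%fset.

Definition axiomC3 n (B : 'M[int]_n) (W : {fset 'M[int]_n}) : Prop :=
  (Phi B W `<=` Phi_plus B W `|` neg_set (Phi_plus B W))%fset.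

Definition axiomC4 n (W : {fset 'M[int]_n}) (ell : 'cV[int]_n) : Prop :=
  forall w, w \in W -> w *m ell = ell.

Definition axiomC5 n (B : 'M[int]_n) (W : {fset 'M[int]_n})
    (Delta : {fset 'cV[int]_n}) (ell : 'cV[int]_n) : Prop :=
  \sum_(g <- Phi_plus B W) g - \sum_(a <- Delta_plus B Delta) a = ell.

Definition axiomC6 n (B : 'M[int]_n) (ell : 'cV[int]_n) : Prop :=
  forall eta, eta \in Sigma_dual B -> 0 < pairing ell eta.

Definition axiomC7 n (B : 'M[int]_n) (W : {fset 'M[int]_n})
    (Delta : {fset 'cV[int]_n}) (ell : 'cV[int]_n) : Prop :=
  forall eta g, eta \in Sigma1_dual B ell -> g \in (Delta `|` Phi B W)%fset ->
    pairing g eta \in [:: -1; 0; 1].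

Definition axiomC8 (C : fieldType) n (B : 'M[int]_n) (W : {fset 'M[int]_n})
    (ell : 'cV[int]_n) : Prop :=
  forall f g : {scalar 'rV[C]_n},
    (forall w z, w \in W -> f (actV w z) = f z) ->
    (forall w z, w \in W -> g (actV w z) = g z) ->
    (forall eta, eta \in Sigma1_dual B ell -> f (inV C eta) = g (inV C eta)) ->
    forall z, f z = g z.

(* the orbit of g under the group generated by W and -1 *)
Definition pm_orbit n (W : {fset 'M[int]_n}) (g : 'cV[int]_n) :
    {fset 'cV[int]_n} :=
  ([fset w *m g | w in W] `|` [fset - (w *m g) | w in W])%fset.

Definition inV0 (C : fieldType) n (B : 'M[int]_n) (W : {fset 'M[int]_n})
    (rho : 'rV[C]_n) : Prop :=
  forall g1 g2, g1 \in Sigma B -> g2 \in Sigma B -> g1 \in pm_orbit W g2 ->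
    evalV g1 rho = evalV g2 rho.

Definition dominant (C : fieldType) n (B : 'M[int]_n)
    (Delta : {fset 'cV[int]_n}) (rho : 'rV[C]_n) : Prop :=
  forall a, a \in Delta_plus B Delta ->
    ~ exists2 m : int, m < 0 & evalV a rho = m%:~R.

Definition regular (C : fieldType) n (B : 'M[int]_n)
    (Delta : {fset 'cV[int]_n}) (rho : 'rV[C]_n) : Prop :=
  forall a, a \in Delta_plus B Delta -> evalV a rho != 0.

Definition invariant_poly (C : fieldType) n (W : {fset 'M[int]_n})
    (p : {mpoly C[n]}) : Prop :=
  forall w (z : 'rV[C]_n), w \in W -> p.@[(actV w z) 0] = p.@[z 0].

Definition delta_values (C : fieldType) n (B : 'M[int]_n) (ell : 'cV[int]_n)
    (rho : 'rV[C]_n) (lam : 'rV[int]_n) (p : {mpoly C[n]}) : Prop :=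
  forall mu, Lambda_plus B mu -> pairing ell mu <= pairing ell lam ->
    p.@[(rho + inV C mu) 0] = (lam == mu)%:R.

(* msize is the total degree plus one, and 0 for the zero polynomial. *)
Definition deg_eq (C : fieldType) n (p : {mpoly C[n]}) (d : int) : Prop :=
  (msize p)%:Z = d + 1.

Definition deg_le (C : fieldType) n (p : {mpoly C[n]}) (d : int) : Prop :=
  (msize p)%:Z <= d + 1.

Definition axiomC9 (C : fieldType) n (B : 'M[int]_n) (W : {fset 'M[int]_n})
    (Delta : {fset 'cV[int]_n}) (ell : 'cV[int]_n) : Prop :=
  exists rho : 'rV[C]_n,
    [/\ inV0 B W rho, regular B Delta rho, dominant B Delta rho
      & forall lam, Lambda_plus B lam ->
          exists! p : {mpoly C[n]},
            [/\ invariant_poly W p, deg_eq p (pairing ell lam)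
              & delta_values B ell rho lam p]].

Definition lin (C : fieldType) n (g : 'cV[int]_n) : {mpoly C[n]} :=
  \sum_(i < n) (g i 0)%:~R *: 'X_i.

(* For rho in V_0 the value does not depend on the element picked. *)
Definition kval (C : fieldType) n (B : 'M[int]_n) (W : {fset 'M[int]_n})
    (rho : 'rV[C]_n) (g : 'cV[int]_n) : C :=
  if [pick i : 'I_n | col i B \in pm_orbit W g] is Some i
  then evalV (col i B) rho else 0.

Definition Lambda1 n (B : 'M[int]_n) (W : {fset 'M[int]_n})
    (ell : 'cV[int]_n) : {fset 'rV[int]_n} :=
  [fset act_dual w eta | w in W, eta in Sigma1_dual B ell]%fset.

Definition f_coef (C : fieldType) n (B : 'M[int]_n) (W : {fset 'M[int]_n})
    (Delta : {fset 'cV[int]_n}) (rho : 'rV[C]_n) (eta : 'rV[int]_n) :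
    {fraction {mpoly C[n]}} :=
  (\prod_(g <- Phi B W | 0 < pairing g eta)
     (lin C g - (kval B W rho g)%:MP))%:F
  / (\prod_(a <- Delta | 0 < pairing a eta) lin C a)%:F.

(* the polynomial z |-> p (z - eta) *)
Definition shift (C : fieldType) n (eta : 'rV[int]_n) (p : {mpoly C[n]}) :
    {mpoly C[n]} :=
  p \mPo [tuple 'X_i - ((eta 0 i)%:~R)%:MP | i < n].

Definition L_op (C : fieldType) n (B : 'M[int]_n) (W : {fset 'M[int]_n})
    (Delta : {fset 'cV[int]_n}) (ell : 'cV[int]_n) (rho : 'rV[C]_n)
    (p : {mpoly C[n]}) : {fraction {mpoly C[n]}} :=
  \sum_(eta <- Lambda1 B W ell) f_coef B W Delta rho eta * (shift eta p)%:F.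

(* The operator is only applied to polynomials; the value is a priori a
   rational function. *)
Definition E_op (C : fieldType) n (B : 'M[int]_n) (W : {fset 'M[int]_n})
    (Delta : {fset 'cV[int]_n}) (ell : 'cV[int]_n) (rho : 'rV[C]_n)
    (p : {mpoly C[n]}) : {fraction {mpoly C[n]}} :=
  (lin C ell * p)%:F - L_op B W Delta ell rho p.

(* The family (v i), for i satisfying I, is a basis of the subspace U; in
   particular i |-> v i is injective on I. *)
Definition family_basis (C : fieldType) (T : lmodType C) (J : choiceType)
    (I : J -> Prop) (v : J -> T) (U : T -> Prop) : Prop :=
  [/\ forall i, I i -> U (v i),
      forall (s : seq J) (c : J -> C), uniq s -> (forall i, i \in s -> I i) ->
        \sum_(i <- s) c i *: v i = 0 -> forall i, i \in s -> c i = 0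
    & forall u, U u -> exists (s : seq J) (c : J -> C),
        [/\ uniq s, forall i, i \in s -> I i & u = \sum_(i <- s) c i *: v i]].

(* Main.v *)
(* Let [delta] be the product of the positive roots.  [L] preserves invariant
   polynomials: [delta * L p] is a polynomial and [L p] has at most simple poles along
   the root hyperplanes, which invariance under the reflections excludes.  As
   [f_eta (rho + mu)] vanishes unless [mu - eta] lies in [Lambda_plus], the value of
   [L p] at [rho + mu] is a combination of the values of [p] at the points
   [rho + mu - eta] with [mu - eta] in [Lambda_plus].  Together with (C8) this gives
   [L 1 = ell - ell rho], so that [E] does not raise the degree, and changing [rho]
   changes [E - ell rho] by an operator that lowers it.

   For the [rho0] of (C9), evaluation on [rho0 + Lambda_plus] identifies the invariant
   polynomials of degree at most [d] with the functions on the part of [Lambda_plus]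
   of level at most [d], and the interpolation polynomials are eigenvectors of [E].
   Hence, for every dominant [rho], [E - ell rho - d] lowers the degree of invariant
   polynomials of degree at most [d].  If such a polynomial vanishes at [rho + mu] for
   [ell mu <= d], then by induction on [d] it is an eigenvector for [ell rho + d], and
   the evaluation formula propagates its zeros to all of [rho + Lambda_plus]: it is
   zero.  Counting dimensions, interpolation at [rho + Lambda_plus] is uniquely
   solvable.

   The auxiliary point [tau], the sum of the dual basis, is regular, lies in [V_0] and
   has [k_omega = 1] for every [omega]. *)
Require Import Defs.
From HB Require Import structures.
From mathcomp Require Import all_boot all_order all_algebra.
From mathcomp Require Import finmap.
From mathcomp Require Import mpoly.
From mathcomp Require Import reals.
From mathcomp Require Import complex.
From mathcomp Require Import ring zify.

Set Implicit Arguments.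
Unset Strict Implicit.
Unset Printing Implicit Defensive.

Import Order.TTheory GRing.Theory Num.Theory.

Local Open Scope ring_scope.

(** * Polynomial functions *)

Lemma poly_neq0_nat (C : numFieldType) (P : {poly C}) :
  P != 0 -> exists k : nat, P.[k%:R] != 0.
Proof.
move=> P0; pose s := [seq k%:R : C | k <- iota 0 (size P)].
have us : uniq s.
  by rewrite map_inj_uniq ?iota_uniq // => a b /eqP; rewrite eqr_nat => /eqP.
have [sP|/allPn[_ /mapP[k _ ->] Pk]] := boolP (all (root P) s); last by exists k.
by have := max_poly_roots P0 sP us; rewrite size_map size_iota ltnn.
Qed.

Lemma poly_eq0_nat (C : numFieldType) (P : {poly C}) :
  (forall k : nat, P.[k%:R] = 0) -> P = 0.
Proof.
move=> h; apply/eqP/negPn/negP => /poly_neq0_nat[k].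
by rewrite h eqxx.
Qed.

Lemma digits_inj n N (a b : 'I_n -> nat) :
  (forall i, a i < N)%N -> (forall i, b i < N)%N ->
  (\sum_(i < n) a i * N ^ i = \sum_(i < n) b i * N ^ i)%N -> a =1 b.
Proof.
elim: n a b => [a b _ _ _ []//|n IH a b ha hb].
rewrite !big_ord_recl !expn0 !muln1.
have E (c : 'I_n.+1 -> nat) : (\sum_(i < n) c (lift ord0 i) * N ^ bump 0 i =
    (\sum_(i < n) c (lift ord0 i) * N ^ i) * N)%N.
  by rewrite big_distrl; apply: eq_bigr => i _; rewrite /bump /= expnSr mulnA.
rewrite !E ![(_ ord0 + _)%N]addnC => e.
have N0 : (0 < N)%N by apply: leq_trans (ha ord0).
have e0 : a ord0 = b ord0.
  by have /(congr1 (modn^~ N)) := e; rewrite !modnMDl !modn_small.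
have e1 := congr1 (divn^~ N) e.
rewrite /= !divnMDl // !divn_small // !addn0 in e1.
have {}IH := IH (a \o lift ord0) (b \o lift ord0) (fun i => ha _) (fun i => hb _) e1.
move=> i; case: (unliftP ord0 i) => [j ->|->] //; exact: IH.
Qed.

(* Kronecker substitution: restrict to the curve [t |-> (t ^ (N ^ i))_i]. *)
Lemma mpoly_eq0_nat (C : numFieldType) n (p : {mpoly C[n]}) :
  (forall c : 'I_n -> nat, p.@[fun i => (c i)%:R] = 0) -> p = 0.
Proof.
move=> h; pose N := msize p; pose e (m : 'X_{1..n}) := (\sum_(i < n) m i * N ^ i)%N.
pose P : {poly C} := \sum_(m <- msupp p) p@_m *: 'X^(e m).
have P0 : P = 0.
  apply: poly_eq0_nat => k; rewrite -[RHS](h (fun i => k ^ (N ^ i)))%N.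
  rewrite mevalE horner_sum; apply: eq_bigr => m _.
  rewrite hornerZ hornerXn; congr (_ * _).
  rewrite expr_sum; apply: eq_bigr => i _.
  by rewrite natrX -exprM mulnC.
apply/mpolyP => m; rewrite mcoeff0.
have [ms|] := boolP (m \in msupp p); last by move/memN_msupp_eq0.
have := congr1 (fun Q : {poly C} => Q`_(e m)) P0.
rewrite coef0 coef_sum (bigD1_seq m) ?msupp_uniq //= coefZ coefXn eqxx mulr1.
rewrite big_seq_cond big1 ?addr0 // => m' /andP[m's ne].
rewrite coefZ coefXn; case: eqP => [ee|_]; last by rewrite mulr0.
suff mm : m' = m by rewrite mm eqxx in ne.
apply/mnmP; apply: (@digits_inj _ N) (esym ee) => i.
  apply: leq_trans (msize_mdeg_lt m's); rewrite ltnS mdegE (bigD1 i) //=.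
  exact: leq_addr.
apply: leq_trans (msize_mdeg_lt ms); rewrite ltnS mdegE (bigD1 i) //=.
exact: leq_addr.
Qed.

Definition ev (C : fieldType) n (p : {mpoly C[n]}) (z : 'rV[C]_n) : C := p.@[z 0].

Lemma mpoly_ev_eq0 (C : numFieldType) n (p : {mpoly C[n]}) :
  (forall z, ev p z = 0) -> p = 0.
Proof.
move=> h; apply: mpoly_eq0_nat => c; rewrite -[RHS](h (\row_i (c i)%:R)).
by apply: meval_eq => i; rewrite mxE.
Qed.

Lemma mpoly_ev_inj (C : numFieldType) n (p q : {mpoly C[n]}) :
  (forall z, ev p z = ev q z) -> p = q.
Proof.
move=> h; apply/eqP; rewrite -subr_eq0; apply/eqP/mpoly_ev_eq0 => z.
by rewrite /ev mevalB -!/(ev _ _) h subrr.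
Qed.

(* Polynomial dependence on a parameter in [C], with values in a [C]-algebra
   given by its structure morphism. *)
Definition polyfam (C A : comNzRingType) (f : {rmorphism C -> A}) (G : C -> A) :=
  exists P : {poly A}, forall t, G t = P.[f t].

Section PolyFam.
Variables (C A : comNzRingType) (f : {rmorphism C -> A}).
Implicit Types G H : C -> A.

Lemma polyfam_ext G H : G =1 H -> polyfam f G -> polyfam f H.
Proof. by move=> e [P h]; exists P => t; rewrite -e. Qed.

Lemma polyfam_cst a : polyfam f (fun=> a).
Proof. by exists a%:P => t; rewrite hornerC. Qed.

Lemma polyfam_id : polyfam f (fun t => f t).
Proof. by exists 'X => t; rewrite hornerX. Qed.

Lemma polyfamD G H : polyfam f G -> polyfam f H -> polyfam f (fun t => G t + H t).
Proof. by move=> [P hP] [Q hQ]; exists (P + Q) => t; rewrite hornerD hP hQ. Qed.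

Lemma polyfamN G : polyfam f G -> polyfam f (fun t => - G t).
Proof. by move=> [P hP]; exists (- P) => t; rewrite hornerN hP. Qed.

Lemma polyfamB G H : polyfam f G -> polyfam f H -> polyfam f (fun t => G t - H t).
Proof. by move=> hG hH; apply: polyfamD => //; apply: polyfamN. Qed.

Lemma polyfamM G H : polyfam f G -> polyfam f H -> polyfam f (fun t => G t * H t).
Proof. by move=> [P hP] [Q hQ]; exists (P * Q) => t; rewrite hornerM hP hQ. Qed.

Lemma polyfam_sum (I : Type) (r : seq I) (Pr : pred I) (F : I -> C -> A) :
  (forall i, polyfam f (F i)) -> polyfam f (fun t => \sum_(i <- r | Pr i) F i t).
Proof.
move=> h; elim: r => [|i r IH].
  by apply: (polyfam_ext _ (polyfam_cst 0)) => t; rewrite big_nil.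
case Pi : (Pr i).
  by apply: (polyfam_ext _ (polyfamD (h i) IH)) => t; rewrite big_cons Pi.
by apply: (polyfam_ext _ IH) => t; rewrite big_cons Pi.
Qed.

Lemma polyfam_prod (I : Type) (r : seq I) (Pr : pred I) (F : I -> C -> A) :
  (forall i, polyfam f (F i)) -> polyfam f (fun t => \prod_(i <- r | Pr i) F i t).
Proof.
move=> h; elim: r => [|i r IH].
  by apply: (polyfam_ext _ (polyfam_cst 1)) => t; rewrite big_nil.
case Pi : (Pr i).
  by apply: (polyfam_ext _ (polyfamM (h i) IH)) => t; rewrite big_cons Pi.
by apply: (polyfam_ext _ IH) => t; rewrite big_cons Pi.
Qed.

End PolyFam.

Local Notation polyfun := (polyfam idfun).

Lemma polyfunX (C : comNzRingType) : polyfun (fun t : C => t).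
Proof. exact: polyfam_id. Qed.

Lemma polyfun_affine (C : comNzRingType) (a b : C) : polyfun (fun t : C => a + t * b).
Proof.
by apply: polyfamD (polyfam_cst _ _) (polyfamM (polyfunX C) (polyfam_cst _ _)).
Qed.

(** The product of the two underlying polynomials has infinitely many zeros. This is the
    continuation principle used throughout: a relation checked for generic [t] holds for all [t], in
    particular at [t = 0]. *)
Lemma polyfun_idomain (C : numFieldType) (a b : C -> C) t1 :
  polyfun a -> polyfun b -> (forall t, a t * b t = 0) -> a t1 != 0 ->
  forall t, b t = 0.
Proof.
move=> [P hP] [Q hQ] h a0.
have /eqP : P * Q = 0.
  by apply: poly_eq0_nat => k; rewrite hornerM -(hP k%:R) -(hQ k%:R) h.
rewrite mulf_eq0 => /orP[/eqP P0|/eqP Q0] t; last by rewrite hQ Q0 horner0.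
by rewrite hP P0 horner0 eqxx in a0.
Qed.

Lemma polyfun_nat (C : numFieldType) (a : C -> C) : polyfun a ->
  (forall k : nat, a k.+1%:R = 0) -> forall t, a t = 0.
Proof.
move=> [P hP] h; suff P0 : P = 0 by move=> t; rewrite hP P0 horner0.
apply/eqP; rewrite -[_ == 0](orFb) -(polyX_eq0 C) -mulf_eq0; apply/eqP.
apply: poly_eq0_nat => -[|k]; rewrite hornerM hornerX ?mul0r //.
by rewrite -(hP k.+1%:R) h mulr0.
Qed.

(** Collects the factors that vanish at [t = 0], which exhibits the order of vanishing there when
    the slopes [b i] concerned are nonzero. *)
Lemma prod_affine (C : numFieldType) (I : Type) (r : seq I) (P : pred I)
    (a b : I -> C) (t : C) :
  \prod_(i <- r | P i) (a i + t * b i) =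
  t ^+ count (fun i => P i && (a i == 0)) r *
  \prod_(i <- r | P i) (if a i == 0 then b i else a i + t * b i).
Proof.
elim: r => [|i r IH]; first by rewrite !big_nil expr0 mulr1.
rewrite !big_cons /=; case: (P i) => //=; rewrite IH.
by case: eqP => [->|_] /=; rewrite ?add0n ?add0r ?exprS; ring.
Qed.

Lemma polyfun_prod_affine (C : numFieldType) (I : Type) (r : seq I) (P : pred I)
    (a b : I -> C) :
  polyfun (fun t : C => \prod_(i <- r | P i) (if a i == 0 then b i else a i + t * b i)).
Proof.
apply: polyfam_prod => i; case: (a i == 0); first exact: polyfam_cst.
exact: polyfun_affine.
Qed.

Lemma polyfunXn (C : numFieldType) k : polyfun (fun t : C => t ^+ k).
Proof. by exists 'X^k => t; rewrite hornerXn. Qed.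

Lemma prod_sign (A : comNzRingType) (I : Type) (r : seq I) (P : pred I) (F : I -> A) :
  \prod_(i <- r | P i) F i * (-1) ^+ count P r = \prod_(i <- r | P i) - F i.
Proof.
elim: r => [|i r IH]; first by rewrite !big_nil expr0 mulr1.
rewrite !big_cons /=; case: (P i); rewrite ?add0n // -IH exprD expr1; ring.
Qed.

Lemma count_fset_filter (T : choiceType) (X : {fset T}) (P Q : pred T) :
  count P [fset a in X | Q a]%fset = count (fun a => Q a && P a) X.
Proof.
have p : perm_eq [fset a in X | Q a]%fset (filter Q X).
  apply: uniq_perm; rewrite ?fset_uniq ?filter_uniq ?fset_uniq // => a.
  by rewrite mem_filter !inE andbC.
by rewrite (permP p) count_filter; apply: eq_count => a; rewrite /= andbC.
Qed.

Lemma polyfun_ev (C : numFieldType) n (p : {mpoly C[n]}) (a b : 'rV[C]_n) :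
  polyfun (fun t => ev p (a + t *: b)).
Proof.
rewrite /ev.
have e t : p.@[(a + t *: b) 0] =
    \sum_(m <- msupp p) p@_m * \prod_i (a 0 i + t * b 0 i) ^+ m i.
  by rewrite mevalE; apply: eq_bigr => m _; congr (_ * _); apply: eq_bigr => i _;
     rewrite !mxE.
apply: (polyfam_ext (fun t => esym (e t))).
apply: polyfam_sum => m; apply: polyfamM (polyfam_cst _ _) _.
apply: polyfam_prod => i; elim: (m i) => [|k IH].
  by apply: (polyfam_ext _ (polyfam_cst _ 1)) => t; rewrite expr0.
apply: (polyfam_ext _ (polyfamM (polyfun_affine (a 0 i) (b 0 i)) IH)) => t.
by rewrite exprS.
Qed.

Lemma polyfam_ev (C : numFieldType) n (G : C -> {mpoly C[n]}) (a b : 'rV[C]_n) :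
  polyfam (mpolyC n (R := C)) G -> polyfun (fun t => ev (G t) (a + t *: b)).
Proof.
move=> [P hP].
have e t : ev (G t) (a + t *: b) =
    \sum_(i < size P) ev P`_i (a + t *: b) * t ^+ i.
  rewrite hP horner_coef /ev raddf_sum /=; apply: eq_bigr => i _.
  by rewrite mevalM -rmorphXn /= mevalC.
apply: (polyfam_ext (fun t => esym (e t))).
apply: polyfam_sum => i; apply: polyfamM (polyfun_ev _ _ _) _.
by exists 'X^i => t; rewrite hornerXn.
Qed.

Lemma evalVE (C : fieldType) n (g : 'cV[int]_n) (z : 'rV[C]_n) :
  evalV g z = \sum_i z 0 i * (g i 0)%:~R.
Proof. by rewrite /evalV mxE; apply: eq_bigr => i _; rewrite mxE. Qed.

Lemma ev_lin (C : fieldType) n (g : 'cV[int]_n) (z : 'rV[C]_n) :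
  ev (lin C g) z = evalV g z.
Proof.
rewrite evalVE /ev /lin raddf_sum /=; apply: eq_bigr => i _.
by rewrite mevalZ mevalXU mulrC.
Qed.

Lemma evalVD (C : fieldType) n (g : 'cV[int]_n) (z y : 'rV[C]_n) :
  evalV g (z + y) = evalV g z + evalV g y.
Proof. by rewrite /evalV mulmxDl mxE. Qed.

Lemma evalVN (C : fieldType) n (g : 'cV[int]_n) (z : 'rV[C]_n) :
  evalV g (- z) = - evalV g z.
Proof. by rewrite /evalV mulNmx mxE. Qed.

Lemma evalVB (C : fieldType) n (g : 'cV[int]_n) (z y : 'rV[C]_n) :
  evalV g (z - y) = evalV g z - evalV g y.
Proof. by rewrite evalVD evalVN. Qed.

Lemma evalVZ (C : fieldType) n (g : 'cV[int]_n) a (z : 'rV[C]_n) :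
  evalV g (a *: z) = a * evalV g z.
Proof. by rewrite /evalV -scalemxAl mxE. Qed.

Lemma evalV_opp (C : fieldType) n (g : 'cV[int]_n) (z : 'rV[C]_n) :
  evalV (- g) z = - evalV g z.
Proof. by rewrite /evalV map_mxN mulmxN mxE. Qed.

Lemma evalV_inV (C : fieldType) n (g : 'cV[int]_n) (eta : 'rV[int]_n) :
  evalV g (inV C eta) = (pairing g eta)%:~R.
Proof. by rewrite /evalV /inV -map_mxM mxE. Qed.

Lemma inVB (C : fieldType) n (a b : 'rV[int]_n) : inV C (a - b) = inV C a - inV C b.
Proof. exact: map_mxB. Qed.

Lemma pairingD n (g : 'cV[int]_n) a b : pairing g (a + b) = pairing g a + pairing g b.
Proof. by rewrite /pairing mulmxDl mxE. Qed.

Lemma pairingB n (g : 'cV[int]_n) a b : pairing g (a - b) = pairing g a - pairing g b.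
Proof. by rewrite /pairing mulmxBl !mxE. Qed.

Lemma pairingBl n (g h : 'cV[int]_n) a : pairing (g - h) a = pairing g a - pairing h a.
Proof. by rewrite /pairing mulmxBr !mxE. Qed.

Lemma pairing_opp n (g : 'cV[int]_n) a : pairing (- g) a = - pairing g a.
Proof. by rewrite /pairing mulmxN mxE. Qed.

Lemma linN (C : fieldType) n (g : 'cV[int]_n) : lin C (- g) = - lin C g.
Proof.
rewrite /lin -sumrN; apply: eq_bigr => i _.
by rewrite mxE rmorphN /= scaleNr.
Qed.

Lemma evD (C : fieldType) n (p q : {mpoly C[n]}) z : ev (p + q) z = ev p z + ev q z.
Proof. exact: mevalD. Qed.
Lemma evN (C : fieldType) n (p : {mpoly C[n]}) z : ev (- p) z = - ev p z.
Proof. exact: mevalN. Qed.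
Lemma evB (C : fieldType) n (p q : {mpoly C[n]}) z : ev (p - q) z = ev p z - ev q z.
Proof. exact: mevalB. Qed.
Lemma evM (C : fieldType) n (p q : {mpoly C[n]}) z : ev (p * q) z = ev p z * ev q z.
Proof. exact: mevalM. Qed.
Lemma evZ (C : fieldType) n (p : {mpoly C[n]}) c z : ev (c *: p) z = c * ev p z.
Proof. exact: mevalZ. Qed.
Lemma evC (C : fieldType) n c (z : 'rV[C]_n) : ev c%:MP z = c.
Proof. exact: mevalC. Qed.
Lemma ev0 (C : fieldType) n (z : 'rV[C]_n) : ev 0 z = 0.
Proof. exact: meval0. Qed.
Lemma ev1 (C : fieldType) n (z : 'rV[C]_n) : ev 1 z = 1.
Proof. exact: meval1. Qed.

Lemma ev_sum (C : fieldType) n (I : Type) (r : seq I) (P : pred I)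
    (F : I -> {mpoly C[n]}) z :
  ev (\sum_(i <- r | P i) F i) z = \sum_(i <- r | P i) ev (F i) z.
Proof. exact: raddf_sum. Qed.

Lemma ev_prod (C : fieldType) n (I : Type) (r : seq I) (P : pred I)
    (F : I -> {mpoly C[n]}) z :
  ev (\prod_(i <- r | P i) F i) z = \prod_(i <- r | P i) ev (F i) z.
Proof. exact: rmorph_prod. Qed.

Lemma ev_shift (C : fieldType) n (eta : 'rV[int]_n) (p : {mpoly C[n]}) z :
  ev (shift eta p) z = ev p (z - inV C eta).
Proof.
rewrite /ev /shift comp_mpoly_meval; apply: meval_eq => i.
by rewrite tnth_mktuple mevalB mevalXU mevalC !mxE.
Qed.

(** * Divisibility by products of linear forms *)

Lemma cV_neq0_coord n (a : 'cV[int]_n) : a != 0 -> exists i, a i 0 != 0.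
Proof.
move=> a0; apply/existsP; apply: contraNT a0; rewrite negb_exists => /forallP h0.
by apply/eqP/colP => i; rewrite mxE; apply/eqP; have := h0 i; rewrite negbK.
Qed.

(** For a coordinate [i] with [a i 0 != 0], the substitution [phi] is the projection onto the
    hyperplane [a = 0] along the [i]-th axis. It changes [p] only by a multiple of [lin C a], and
    [p \mPo phi] is zero because its arguments lie on the hyperplane. *)
Lemma mpoly_lin_dvd (C : numFieldType) n (a : 'cV[int]_n) (p : {mpoly C[n]}) :
  a != 0 -> (forall z, evalV a z = 0 -> ev p z = 0) ->
  exists q, p = lin C a * q.
Proof.
move=> /cV_neq0_coord[i ai] h.
have aiC : (a i 0)%:~R != 0 :> C by rewrite intr_eq0.
pose l : {mpoly C[n]} := (a i 0)%:~R^-1 *: lin C a.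
pose phi := [tuple 'X_j - (j == i)%:R *: l | j < n].
have [q hq] : exists q, p = (p \mPo phi) + lin C a * q.
  clear h; elim/mpolyind: p => [|c m p _ _ [q hq]].
    by exists 0; rewrite comp_mpoly0 mulr0 addr0.
  have [r hr] : exists r, 'X_[m] = ('X_[m] \mPo phi) + lin C a * r :> {mpoly C[n]}.
    rewrite comp_mpolyX mpolyXE_id.
    elim: (index_enum _) => [|j s [r hr]].
      by exists 0; rewrite !big_nil mulr0 addr0.
    rewrite !big_cons tnth_mktuple {1}hr.
    have [u hu] : exists u, 'X_j ^+ m j =
        ('X_j - (j == i)%:R *: l) ^+ m j + lin C a * u.
      elim: (m j) => [|k [u hu]]; first by exists 0; rewrite !expr0 mulr0 addr0.
      exists (u * 'X_j + ((j == i)%:R * (a i 0)%:~R^-1) *: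
               ('X_j - (j == i)%:R *: l) ^+ k).
      rewrite !exprS {1}hu /l -!mul_mpolyC mpolyCM; ring.
    rewrite hu; set A := (_ - _) ^+ _; set P := \prod_(_ <- _) _.
    exists (u * (P + lin C a * r) + A * r); ring.
  exists (c *: r + q); rewrite comp_mpolyD comp_mpolyZ {1}hr {1}hq -!mul_mpolyC; ring.
suff e : p \mPo phi = 0 by exists q; rewrite {1}hq e add0r.
apply: mpoly_ev_eq0 => z; rewrite /ev comp_mpoly_meval.
pose y : 'rV[C]_n := z - ((a i 0)%:~R^-1 * evalV a z) *: delta_mx 0 i.
rewrite -[RHS](h y) => [|].
  apply: meval_eq => j; rewrite tnth_mktuple mevalB mevalXU !mevalZ -!/(ev _ _) ev_lin.
  by rewrite !mxE eqxx /= mulrC.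
rewrite evalVB evalVZ.
have -> : evalV a (delta_mx 0 i) = (a i 0)%:~R :> C.
  by rewrite /evalV -rowE !mxE.
by rewrite mulrAC mulVf // mul1r subrr.
Qed.

Lemma hyperplane_prime (C : numFieldType) n (a b : 'cV[int]_n) (v : 'rV[C]_n)
    (p : {mpoly C[n]}) : evalV a v = 0 -> evalV b v != 0 ->
  (forall z, evalV a z = 0 -> evalV b z * ev p z = 0) ->
  forall z, evalV a z = 0 -> ev p z = 0.
Proof.
move=> av bv h z az.
(* Inside the hyperplane, move along [v], where [b] is not constant; at the chosen parameter [b]
   takes the value 1. *)
have := @polyfun_idomain _ _ (fun t => ev p (z + t *: v)) 
  ((1 - evalV b z) / evalV b v) (polyfun_affine (evalV b z) (evalV b v))
  (polyfun_ev p z v) _ _ 0.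
rewrite scale0r addr0; apply.
  move=> t; have := h (z + t *: v); rewrite evalVD evalVZ av mulr0 addr0 => /(_ az).
  by rewrite evalVD evalVZ.
by rewrite divfK // addrC subrK oner_eq0.
Qed.

(** Non-proportionality in the form in which it is used: a direction along the hyperplane of [a] and
    transversal to that of [b]. *)
Definition nonprop (C : fieldType) n (a b : 'cV[int]_n) :=
  exists v : 'rV[C]_n, evalV a v = 0 /\ evalV b v != 0.

Lemma hyperplane_prime_prod (C : numFieldType) n (a : 'cV[int]_n)
    (s : seq 'cV[int]_n) (p : {mpoly C[n]}) :
  (forall b, b \in s -> nonprop C a b) ->
  (forall z, evalV a z = 0 -> \prod_(b <- s) evalV b z * ev p z = 0) ->
  forall z, evalV a z = 0 -> ev p z = 0.
Proof.
elim: s p => [|b s IH] p hs h z az.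
  by have := h z az; rewrite big_nil mul1r.
have [v [av bv]] := hs b (mem_head _ _).
apply: (hyperplane_prime av bv) az => y ay.
rewrite -ev_lin -evM; apply: (IH _ _ _ y ay) => [c cs|x ax].
  by apply: hs; rewrite inE cs orbT.
by have := h x ax; rewrite big_cons evM ev_lin mulrA [evalV b x * _]mulrC.
Qed.

(** Divide by one form at a time: by [hyperplane_prime] the quotient still vanishes on the remaining
    hyperplanes. *)
Lemma mpoly_prodlin_dvd (C : numFieldType) n (s : seq 'cV[int]_n)
    (p : {mpoly C[n]}) : uniq s ->
  (forall a, a \in s -> a != 0) ->
  (forall a b, a \in s -> b \in s -> a != b -> nonprop C a b) ->
  (forall a, a \in s -> forall z, evalV a z = 0 -> ev p z = 0) ->
  exists q, p = (\prod_(a <- s) lin C a) * q.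
Proof.
elim: s p => [|a s IH] p /=.
  by move=> _ _ _ _; exists p; rewrite big_nil mul1r.
move=> /andP[as_ us] s0 sp h.
have [q hq] := mpoly_lin_dvd (s0 a (mem_head _ _)) (h a (mem_head _ _)).
have ins b : b \in s -> b \in a :: s by rewrite inE orbC => ->.
have [b bs|b c bs cs bc|b bs|r hr] := IH q us.
- exact/s0/ins.
- by apply: sp => //; apply: ins.
- have [|v [bv av]] := sp b a (ins b bs) (mem_head _ _).
    by apply: contraNneq as_ => <-.
  apply: (hyperplane_prime bv av) => z bz.
  by rewrite -ev_lin -evM -hq; apply: (h b (ins b bs)).
by exists r; rewrite big_cons hq hr mulrA.
Qed.

Lemma lin_neq0 (C : numFieldType) n (a : 'cV[int]_n) : a != 0 -> lin C a != 0.
Proof.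
move=> /cV_neq0_coord[i ai].
apply/eqP => /(congr1 (fun p => ev p (delta_mx 0 i))); rewrite ev0 ev_lin.
by rewrite /evalV -rowE !mxE => /eqP; rewrite intr_eq0 (negbTE ai).
Qed.

(** The division can be done coefficientwise in [t]: on a hyperplane of [s] the family vanishes at
    every natural [t], hence so does each coefficient. *)
Lemma polyfam_quot (C : numFieldType) n (s : seq 'cV[int]_n)
    (G : C -> {mpoly C[n]}) : uniq s ->
  (forall a, a \in s -> a != 0) ->
  (forall a b, a \in s -> b \in s -> a != b -> nonprop C a b) ->
  (forall t, exists q, \prod_(a <- s) lin C a * q = G t) ->
  polyfam (mpolyC n (R := C)) G ->
  exists2 Q, polyfam (mpolyC n (R := C)) Q &
     forall t, \prod_(a <- s) lin C a * Q t = G t.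
Proof.
move=> us s0 sp hq [P hP].
set d := \prod_(a <- s) _ in hq *.
have [f hf] : exists f : nat -> {mpoly C[n]},
    forall k, (k < size P)%N -> P`_k = d * f k.
  suff h (k : nat) : exists q, P`_k = d * q.
    elim: (size P) => [|m [f hf]]; first by exists (fun=> 0).
    have [q hqm] := h m; exists (fun k => if k == m then q else f k) => k.
    by rewrite ltnS leq_eqVlt; case: eqP => [->|_] //= /hf.
  apply: mpoly_prodlin_dvd => // a as_ z az.
  pose R : {poly C} := \poly_(i < size P) ev P`_i z.
  suff R0 : R = 0.
    have [sk|sk] := ltnP k (size P); last by rewrite nth_default // ev0.
    by have := congr1 (fun p : {poly C} => p`_k) R0; rewrite coef_poly sk coef0.
  apply: poly_eq0_nat => j; have [q e] := hq j%:R.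
  have /(congr1 (fun p => ev p z)) := e.
  rewrite hP evM /d ev_prod (big_rem a as_) /= ev_lin az !mul0r horner_coef ev_sum.
  move=> e0; rewrite horner_poly [RHS]e0; apply: eq_bigr => i _.
  by rewrite evM /ev rmorphXn /= mevalC.
exists (fun t => (\poly_(i < size P) f i).[t%:MP]); first by eexists.
move=> t; rewrite /= hP horner_poly horner_coef big_distrr; apply: eq_bigr => i _.
by rewrite /= hf // mulrA.
Qed.

(** * Degree estimates *)

(* [msize] is one more than the degree, so [msize p <= k] reads [deg p < k]. *)
Lemma msizeM_leq (C : fieldType) n (p q : {mpoly C[n]}) a b :
  (msize p <= a)%N -> (msize q <= b)%N -> (msize (p * q) <= (a + b).-1)%N.
Proof.
move=> pa qb.
have [->|p0] := eqVneq p 0; first by rewrite mul0r msize0.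
have [->|q0] := eqVneq q 0; first by rewrite mulr0 msize0.
by rewrite msizeM // -!subn1; apply: leq_sub2r; apply: leq_add.
Qed.

Lemma msizeD_leq (C : fieldType) n (p q : {mpoly C[n]}) a :
  (msize p <= a)%N -> (msize q <= a)%N -> (msize (p + q) <= a)%N.
Proof.
by move=> pa qa; apply: leq_trans (msizeD_le p q) _; rewrite geq_max pa qa.
Qed.

Lemma msizeB_leq (C : fieldType) n (p q : {mpoly C[n]}) a :
  (msize p <= a)%N -> (msize q <= a)%N -> (msize (p - q) <= a)%N.
Proof. by move=> pa qa; apply: msizeD_leq; rewrite ?msizeN. Qed.

Lemma msize_sum_leq (C : fieldType) n (I : eqType) (r : seq I) (P : pred I)
    (F : I -> {mpoly C[n]}) a :
  (forall i, i \in r -> P i -> (msize (F i) <= a)%N) ->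
  (msize (\sum_(i <- r | P i) F i) <= a)%N.
Proof.
move=> h; rewrite big_seq_cond.
apply: (big_ind (fun p => msize p <= a)%N) => [||i /andP[]].
- by rewrite msize0.
- by move=> p q hp hq; apply: msizeD_leq.
- by move=> ir Pi; apply: h.
Qed.

Lemma msize_prod_leq (C : fieldType) n (I : Type) (r : seq I) (P : pred I)
    (F : I -> {mpoly C[n]}) : (forall i, (msize (F i) <= 2)%N) ->
  (msize (\prod_(i <- r | P i) F i) <= (count P r).+1)%N.
Proof.
move=> h; elim: r => [|i r IH]; first by rewrite big_nil msize1.
rewrite big_cons /=; case: (P i) => //=.
exact: (msizeM_leq (h i) IH).
Qed.

(** Telescoping: replacing one factor at a time loses one degree, since [F i - H i] is constant. *)
Lemma msize_prodB_leq (C : fieldType) n (I : Type) (r : seq I) (P : pred I)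
    (F H : I -> {mpoly C[n]}) : (forall i, (msize (F i) <= 2)%N) ->
  (forall i, (msize (H i) <= 2)%N) -> (forall i, (msize (F i - H i)%R <= 1)%N) ->
  (msize (\prod_(i <- r | P i) F i - \prod_(i <- r | P i) H i)%R <= count P r)%N.
Proof.
move=> hF hH hB; elim: r => [|i r IH]; first by rewrite !big_nil subrr msize0.
rewrite !big_cons /=; case: (P i) => //=.
set p := \prod_(_ <- _ | _) _ in IH *; set q := \prod_(_ <- _ | _) _ in IH *.
have -> : F i * p - H i * q = F i * (p - q) + (F i - H i) * q by ring.
apply: msizeD_leq; first exact: msizeM_leq (hF i) IH.
exact: msizeM_leq (hB i) (msize_prod_leq _ _ hH).
Qed.

Lemma msize_lin (C : fieldType) n (g : 'cV[int]_n) : (msize (lin C g) <= 2)%N.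
Proof.
apply: msize_sum_leq => i _ _; apply: leq_trans (msizeZ_le _ _) _.
by rewrite msizeX mdeg1.
Qed.

Lemma msizeC_leq (C : fieldType) n (c : C) : (msize (c%:MP : {mpoly C[n]}) <= 1)%N.
Proof. by rewrite msizeC; case: (c != 0). Qed.

Lemma msize_linB (C : fieldType) n (g : 'cV[int]_n) (c : C) :
  (msize (lin C g - c%:MP) <= 2)%N.
Proof.
by apply: msizeB_leq (msize_lin _ _) _; apply: leq_trans (msizeC_leq _ _) _.
Qed.

Lemma msize_mul_cancel (C : fieldType) n (d p : {mpoly C[n]}) m k :
  msize d = m.+1 -> (msize (d * p) <= m + k)%N -> (msize p <= k)%N.
Proof.
move=> dm; have [->|p0] := eqVneq p 0; first by rewrite msize0.
have d0 : d != 0 by rewrite -msize_poly_eq0 dm.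
by rewrite msizeM // dm addSn /= leq_add2l.
Qed.

Lemma msize_prodlin (C : numFieldType) n (s : seq 'cV[int]_n) :
  (forall a, a \in s -> a != 0) ->
  msize (\prod_(a <- s) lin C a) = (size s).+1.
Proof.
elim: s => [|a s IH] s0; first by rewrite big_nil msize1.
have a0 : lin C a != 0 by apply/lin_neq0/s0/mem_head.
have {}IH : msize (\prod_(a <- s) lin C a) = (size s).+1.
  by apply: IH => b bs; apply: s0; rewrite inE bs orbT.
have p0 : \prod_(a <- s) lin C a != 0 by rewrite -msize_poly_eq0 IH.
rewrite big_cons msizeM // IH addnS /=.
suff -> : msize (lin C a) = 2 by [].
apply/eqP; rewrite eqn_leq msize_lin /= ltnNge; apply/negP => h.
have := msize1_polyC h; set c := _@__ => e.
have c0 : c = 0 by have := ev_lin a 0 (C := C); rewrite e evC /evalV mul0mx mxE.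
by rewrite e c0 mpolyC0 eqxx in a0.
Qed.

(** By linearity it is enough to treat monomials, where a telescoping over the variables cancels the
    terms of top degree. *)
Lemma msize_shiftB (C : fieldType) n (eta : 'rV[int]_n) (p : {mpoly C[n]}) :
  (msize (shift eta p - p) <= (msize p).-1)%N.
Proof.
pose phi : n.-tuple {mpoly C[n]} := [tuple 'X_i - ((eta 0 i)%:~R)%:MP | i < n].
have hX (m : 'X_{1..n}) :
    (msize (('X_[m] \mPo phi) - 'X_[m] : {mpoly C[n]}) <= mdeg m)%N.
  rewrite comp_mpolyX [X in _ - X]mpolyXE_id mdegE.
  elim: (index_enum _) => [|i s IH]; first by rewrite !big_nil subrr msize0.
  rewrite !big_cons tnth_mktuple.
  set c := (_ %:MP).
  have hk k : (msize (('X_i - c) ^+ k : {mpoly C[n]}) <= k.+1)%N.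
    elim: k => [|k IHk]; first by rewrite expr0 msize1.
    rewrite exprS; apply: (msizeM_leq (a := 2) _ IHk).
    apply: msizeB_leq; first by rewrite msizeX mdeg1.
    by apply: leq_trans (msizeC_leq _ _) _.
  have hd k : (msize (('X_i - c) ^+ k - 'X_i ^+ k : {mpoly C[n]}) <= k)%N.
    elim: k => [|k IHk]; first by rewrite !expr0 subrr msize0.
    have -> : ('X_i - c) ^+ k.+1 - 'X_i ^+ k.+1 =
       'X_i * (('X_i - c) ^+ k - 'X_i ^+ k) - c * ('X_i - c) ^+ k.
      by rewrite !exprS; ring.
    apply: msizeB_leq.
      by apply: (msizeM_leq (a := 2) _ IHk); rewrite msizeX mdeg1.
    exact: (msizeM_leq (a := 1) (msizeC_leq _ _) (hk k)).
  set P := \prod_(_ <- _) _ in IH *; set Q := \prod_(_ <- _) _ in IH *.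
  have -> : ('X_i - c) ^+ m i * P - 'X_i ^+ m i * Q =
     ('X_i - c) ^+ m i * (P - Q) + (('X_i - c) ^+ m i - 'X_i ^+ m i) * Q by ring.
  have hQ : (msize Q <= (\sum_(j <- s) m j).+1)%N.
    rewrite /Q; elim: (s) => [|j s' IHs]; first by rewrite !big_nil msize1.
    rewrite !big_cons -addnS; apply: (msizeM_leq (a := (m j).+1) _ IHs).
    rewrite mpolyXn msizeX mdegMn mdeg1; lia.
  apply: msizeD_leq.
    exact: (msizeM_leq (hk _) IH).
  apply: leq_trans (msizeM_leq (hd _) hQ) _; lia.
have -> : shift eta p - p = \sum_(m <- msupp p) p@_m *: (('X_[m] \mPo phi) - 'X_[m]).
  rewrite {2}[p]mpolyE /shift comp_mpolyEX -sumrB; apply: eq_bigr => m _.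
  by rewrite scalerBr.
apply: msize_sum_leq => m ms _; apply: leq_trans (msizeZ_le _ _) _.
apply: leq_trans (hX m) _; have := msize_mdeg_lt ms.
by case: (msize p).
Qed.

Lemma msize_leq2 (C : fieldType) n (q : {mpoly C[n]}) : (msize q <= 2)%N ->
  exists f : {scalar 'rV[C]_n}, forall z, ev q z = f z + ev q 0.
Proof.
move=> q2; pose c : 'cV[C]_n := \col_i q@_(U_(i)).
pose f (z : 'rV[C]_n) : C := (z *m c) 0 0.
have lf : linear_for *%R f by move=> a y z; rewrite /f mulmxDl -scalemxAl !mxE.
pose F : {scalar 'rV[C]_n} := HB.pack f (GRing.isLinear.Build _ _ _ _ f lf).
exists F => z; rewrite -[F z]/(f z).
have -> : q = (q@_0)%:MP + \sum_i q@_(U_(i)) *: 'X_i.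
  apply/mpolyP => m; rewrite mcoeffD mcoeffC raddf_sum /=.
  under eq_bigr do rewrite mcoeffZ mcoeffX.
  have [m2|m2] := ltnP 1 (mdeg m).
    rewrite memN_msupp_eq0; last first.
      by apply/negP => /msize_mdeg_lt h; have := leq_trans h q2; rewrite ltnNge m2.
    rewrite -mdeg_eq0 gtn_eqF ?mulr0 ?add0r; last exact: leq_trans m2.
    rewrite big1 // => i _; case: eqP => [e|]; last by rewrite mulr0.
    by rewrite -e mdeg1 in m2.
  have [->|m0] := eqVneq m 0%MM.
    rewrite mulr1 big1 ?addr0 // => i _.
    case: eqP => [e|]; last by rewrite mulr0.
    by have := mdeg1 i; rewrite e mdeg0.
  have /mdeg1P[i /eqP ->] : mdeg m == 1%N.
    by rewrite eqn_leq m2 lt0n mdeg_eq0.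
  rewrite mulr0 add0r (bigD1 i) //= eqxx mulr1 big1 ?addr0 // => j ji.
  case: eqP => [e|]; last by rewrite mulr0.
  have := congr1 (fun m : 'X_{1..n} => m i) e; rewrite !mnm1E eqxx.
  by rewrite (negbTE ji).
have evS y : ev (\sum_i q@_(U_(i)) *: 'X_i) y = f y.
  rewrite ev_sum /f mxE; apply: eq_bigr => i _.
  by rewrite evZ /ev mevalXU mxE mulrC.
by rewrite !evD !evC !evS addrC {3}/f mul0mx mxE addr0.
Qed.

(** * Reflection-invariant sums with simple poles *)

Lemma perm_map_stable (T : choiceType) (f : T -> T) (X : {fset T}) :
  injective f -> (forall x, x \in X -> f x \in X) -> perm_eq (map f X) X.
Proof.
move=> fi fX; have us : uniq (map f X) by rewrite map_inj_uniq ?fset_uniq.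
have sX : {subset map f X <= X} by move=> _ /mapP[y yX ->]; apply: fX.
have [|_ e] := uniq_min_size us sX; first by rewrite size_map.
exact: uniq_perm us (fset_uniq X) e.
Qed.

Section Reflection.
Variables (n : nat) (a : 'cV[int]_n) (c : 'rV[int]_n).
Hypothesis ac : pairing a c = 2.
Local Notation S := (refl_mx a c).

Lemma refl_mxK : S *m S = 1%:M.
Proof.
rewrite /refl_mx mulmxBl mul1mx mulmxBr mulmx1.
rewrite -mulmxA [c *m _]mulmxA.
have -> : c *m a = 2%:M by rewrite [LHS]mx11_scalar -/(pairing a c) ac.
rewrite mul_scalar_mx -scalemxAr scaler_nat mulr2n opprB.
by rewrite addrK subrK.
Qed.

Lemma refl_root : S *m a = - a.
Proof.
rewrite /refl_mx mulmxBl mul1mx -mulmxA.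
have -> : c *m a = 2%:M by rewrite [LHS]mx11_scalar -/(pairing a c) ac.
by rewrite mul_mx_scalar scaler_nat mulr2n opprD addNKr.
Qed.

Lemma refl_unitmx : S \in unitmx.
Proof. by have /mulmx1_unit[] := refl_mxK. Qed.

Lemma invmx_refl : invmx S = S.
Proof. by rewrite -[LHS]mulmx1 -refl_mxK mulKmx // refl_unitmx. Qed.

End Reflection.

Lemma pairing_mul n (w : 'M[int]_n) g eta : pairing (w *m g) eta = pairing g (eta *m w).
Proof. by rewrite /pairing mulmxA. Qed.

Lemma evalV_mul (C : fieldType) n (w : 'M[int]_n) g (z : 'rV[C]_n) :
  evalV (w *m g) z = evalV g (z *m map_mx intr w).
Proof. by rewrite /evalV map_mxM mulmxA. Qed.

Lemma inV_mul (C : fieldType) n (w : 'M[int]_n) eta :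
  inV C (eta *m w) = inV C eta *m map_mx intr w.
Proof. exact: map_mxM. Qed.

Lemma refl_fixV (C : fieldType) n (a : 'cV[int]_n) c (z : 'rV[C]_n) :
  evalV a z = 0 -> z *m map_mx intr (refl_mx a c) = z.
Proof.
move=> az; rewrite /refl_mx map_mxB map_mx1 mulmxBr mulmx1 map_mxM mulmxA.
have -> : z *m map_mx intr a = 0.
  by apply/matrixP => i j; rewrite !ord1 -/(evalV a z) az mxE.
by rewrite mul0mx subr0.
Qed.

Lemma refl_fix n (a : 'cV[int]_n) c (mu : 'rV[int]_n) :
  pairing a mu = 0 -> mu *m refl_mx a c = mu.
Proof.
move=> am; rewrite /refl_mx mulmxBr mulmx1 mulmxA.
have -> : mu *m a = 0.
  by apply/matrixP => i j; rewrite !ord1 -/(pairing a mu) am mxE.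
by rewrite mul0mx subr0.
Qed.

Section HalfSystem.
Variables (n : nat) (D Dp : {fset 'cV[int]_n}) (tau : 'rV[int]_n).
Hypothesis hD : D = (Dp `|` neg_set Dp)%fset.
Hypothesis htau : forall a, a \in Dp -> 0 < pairing a tau.

Lemma half_perm : perm_eq D (enum_fset Dp ++ map -%R (enum_fset Dp)).
Proof.
apply: uniq_perm; first exact: fset_uniq.
  rewrite cat_uniq fset_uniq map_inj_uniq ?fset_uniq ?andbT /=; last exact: oppr_inj.
  apply/hasPn => _ /mapP[a aD ->]; apply/negP => /htau; rewrite pairing_opp.
  have := htau aD; lia.
move=> a; rewrite hD mem_cat in_fsetU; congr (_ || _).
by apply/imfsetP/mapP => -[b /= bD ->]; exists b.
Qed.

Lemma half_mem a : a \in D -> a \in Dp \/ - a \in Dp.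
Proof.
rewrite hD in_fsetU => /orP[|/imfsetP[b /= bD ->]]; first by left.
by right; rewrite opprK.
Qed.

Lemma half_sub a : a \in Dp -> a \in D.
Proof. by rewrite hD in_fsetU => ->. Qed.

(** Each [a] in [Dp] occurs once: as itself if [a(eta) > 0], as [- a] with a correcting sign if
    [a(eta) < 0], and in the last product if [a(eta) = 0]. *)
Lemma half_prod (A : comNzRingType) (F : 'cV[int]_n -> A) eta :
  (forall a, F (- a) = - F a) ->
  \prod_(a <- D | 0 < pairing a eta) F a *
   (\prod_(a <- Dp | pairing a eta < 0) (-1) *
    \prod_(a <- Dp | pairing a eta == 0) F a) = \prod_(a <- Dp) F a.
Proof.
move=> FN; rewrite (perm_big _ half_perm) big_cat big_map /=.
rewrite big_mkcond [X in _ * X * _]big_mkcond [X in _ * (X * _)]big_mkcond /=.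
rewrite [X in _ * (_ * X)]big_mkcond -!big_split /=; apply: eq_bigr => a _.
rewrite pairing_opp oppr_gt0 FN.
by case: ltgtP => _; ring.
Qed.

Lemma half_count eta :
  (count (fun a => 0 < pairing a eta)%R D +
   count (fun a => pairing a eta == 0%R)  Dp = size Dp)%N.
Proof.
rewrite (permP half_perm) count_cat count_map.
elim: (enum_fset Dp) => //= a s <-; rewrite pairing_opp oppr_gt0.
case: ltgtP => _ /=; lia.
Qed.

End HalfSystem.

Lemma exists_regular (C : numFieldType) n (s : seq 'cV[int]_n) (z v : 'rV[C]_n) :
  (forall a, a \in s -> evalV a v != 0) ->
  exists t : C, ev (\prod_(a <- s) lin C a) (z + t *: v) != 0.
Proof.
move=> hs; pose P : {poly C} := \prod_(a <- s) ((evalV a z)%:P + evalV a v *: 'X).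
have P0 : P != 0.
  rewrite /P {P}; elim: s hs => [|a s IH] hs; first by rewrite big_nil oner_eq0.
  rewrite big_cons mulf_neq0 ?IH // => [|b bs]; last by apply: hs; rewrite inE bs orbT.
  apply/eqP => /(congr1 (fun p : {poly C} => p`_1)).
  rewrite coefD coefC coefZ coefX coef0 add0r mulr1 => /eqP.
  by rewrite (negbTE (hs a (mem_head _ _))).
have [k Pk] := poly_neq0_nat P0; exists k%:R.
apply: contraNneq Pk => e; apply/eqP; rewrite -[RHS]e.
rewrite ev_prod /P horner_prod; apply: eq_bigr => a _.
by rewrite ev_lin evalVD evalVZ hornerD hornerC hornerZ hornerX mulrC.
Qed.

Section Polynomiality.
Variables (C : numFieldType) (n : nat).
Variables (co : 'cV[int]_n -> 'rV[int]_n) (D Dp Psi : {fset 'cV[int]_n}).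
Variables (k : 'cV[int]_n -> C) (X : {fset 'rV[int]_n}) (tau : 'rV[int]_n).

Definition num_poly eta : {mpoly C[n]} :=
  \prod_(g <- Psi | 0 < pairing g eta) (lin C g - (k g)%:MP).
Definition den_poly eta : {mpoly C[n]} := \prod_(a <- D | 0 < pairing a eta) lin C a.
(** The polynomial [disc_poly / den_poly eta], see [den_cof]. *)
Definition cof_poly eta : {mpoly C[n]} :=
  \prod_(a <- Dp | pairing a eta < 0) (-1) *
  \prod_(a <- Dp | pairing a eta == 0) lin C a.
Definition disc_poly : {mpoly C[n]} := \prod_(a <- Dp) lin C a.
(* [disc_poly] times the operator with coefficients [num_poly / den_poly] *)
Definition cleared_op (p : {mpoly C[n]}) : {mpoly C[n]} :=
  \sum_(eta <- X) num_poly eta * cof_poly eta * shift eta p.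

Local Notation S := (fun a => refl_mx a (co a)).

Definition refl_inv (p : {mpoly C[n]}) := forall a z, a \in D ->
  ev p (z *m map_mx intr (S a)) = ev p z.

Hypothesis hco : forall a, a \in D -> pairing a (co a) = 2.
Hypothesis hstD : forall a b, a \in D -> b \in D -> S a *m b \in D.
Hypothesis hD : D = (Dp `|` neg_set Dp)%fset.
Hypothesis htau : forall a, a \in Dp -> 0 < pairing a tau.
Hypothesis hnp : forall a b, a \in Dp -> b \in Dp -> a != b -> nonprop C a b.
Hypothesis hstP : forall a g, a \in D -> g \in Psi -> S a *m g \in Psi.
Hypothesis hk : forall a g, a \in D -> g \in Psi -> k (S a *m g) = k g.
Hypothesis hstX : forall a eta, a \in D -> eta \in X -> eta *m S a \in X.

Lemma disc_neq0P z :
  reflect (forall a, a \in D -> evalV a z != 0) (ev disc_poly z != 0).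
Proof.
rewrite ev_prod; apply: (iffP idP) => [h a|h].
  rewrite prodf_seq_neq0 in h; move/allP: h => h.
  case/(half_mem hD) => /h; rewrite /= ev_lin // evalV_opp oppr_eq0 //.
rewrite prodf_seq_neq0; apply/allP => a aD /=.
by rewrite ev_lin; apply/h/(half_sub hD).
Qed.

Lemma den_cof eta : den_poly eta * cof_poly eta = disc_poly.
Proof. by apply: (half_prod hD htau) => a; apply: linN. Qed.

Lemma den_neq0 eta z : ev disc_poly z != 0 -> ev (den_poly eta) z != 0.
Proof. by rewrite -(den_cof eta) evM mulf_eq0 negb_or => /andP[]. Qed.

Definition coef_val eta z := ev (num_poly eta) z / ev (den_poly eta) z.

Lemma ev_num eta z :
  ev (num_poly eta) z = \prod_(g <- Psi | 0 < pairing g eta) (evalV g z - k g).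
Proof. by rewrite ev_prod; apply: eq_bigr => g _; rewrite evB ev_lin evC. Qed.

Lemma msize_num eta :
  (msize (num_poly eta) <= (count (fun g => 0 < pairing g eta)%R Psi).+1)%N.
Proof. by apply: msize_prod_leq => g; apply: msize_linB. Qed.

Lemma msize_cof eta :
  (msize (cof_poly eta) <= (count (fun a => pairing a eta == 0)%R Dp).+1)%N.
Proof.
have s1 : (msize (\prod_(a <- Dp | (pairing a eta < 0)%R) (-1) : {mpoly C[n]}) <= 1)%N.
  apply: (big_ind (fun p : {mpoly C[n]} => msize p <= 1)%N) => [|p q hp hq|_ _].
  - by rewrite msize1.
  - exact: msizeM_leq hp hq.
  - by rewrite msizeN msize1.
exact: (msizeM_leq s1 (msize_prod_leq _ _ (@msize_lin C n))).
Qed.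

Lemma ev_cleared p z : ev disc_poly z != 0 ->
  ev (cleared_op p) z =
  ev disc_poly z * \sum_(eta <- X) coef_val eta z * ev p (z - inV C eta).
Proof.
move=> z0; rewrite ev_sum big_distrr; apply: eq_bigr => eta _ /=.
rewrite (evM (num_poly _ * _)) (evM (num_poly _)) ev_shift.
rewrite -(den_cof eta) (evM (den_poly _)) /coef_val.
have := den_neq0 eta z0; set d := ev (den_poly _) _ => d0.
by field.
Qed.

Lemma refl_inj a : a \in D -> injective (mulmx (S a) : 'cV_n -> 'cV_n).
Proof.
move=> aD; apply: (can_inj (g := mulmx (S a))) => g.
by rewrite mulmxA refl_mxK ?mul1mx ?hco.
Qed.

Lemma refl_inj_dual a : a \in D -> injective (mulmxr (S a) : 'rV_n -> 'rV_n).
Proof.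
move=> aD; apply: (can_inj (g := mulmxr (S a))) => g.
by rewrite /= -mulmxA refl_mxK ?mulmx1 ?hco.
Qed.

(** The reflection permutes the factors of the numerator and of the denominator and preserves
    [k]. *)
Lemma coef_val_refl a eta z : a \in D ->
  coef_val eta (z *m map_mx intr (S a)) = coef_val (eta *m S a) z.
Proof.
move=> aD; have pS g : pairing (S a *m g) (eta *m S a) = pairing g eta.
  by rewrite pairing_mul -mulmxA refl_mxK ?mulmx1 ?hco.
rewrite /coef_val !ev_num !ev_prod; congr (_ / _).
  have pP := perm_map_stable (refl_inj aD) (fun g => @hstP _ g aD).
  rewrite -[RHS](perm_big _ pP) big_map /=.
  under [RHS]eq_bigl do rewrite pS.
  rewrite big_seq_cond [RHS]big_seq_cond; apply: eq_bigr => g /andP[gP _].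
  by rewrite evalV_mul hk.
have pD := perm_map_stable (refl_inj aD) (fun g => @hstD _ g aD).
rewrite -[RHS](perm_big _ pD) big_map /=.
under [RHS]eq_bigl do rewrite pS.
by apply: eq_bigr => g _; rewrite !ev_lin evalV_mul.
Qed.

Lemma disc_refl_neq0 a z : a \in D -> ev disc_poly z != 0 ->
  ev disc_poly (z *m map_mx intr (S a)) != 0.
Proof.
move=> aD /disc_neq0P h; apply/disc_neq0P => b bD.
by rewrite -evalV_mul; apply/h/hstD.
Qed.

(** Invariance of [cleared_op p / disc_poly], cross-multiplied: the reflection permutes the summands
    over [X]. *)
Lemma cleared_refl p a z : refl_inv p -> a \in D -> ev disc_poly z != 0 ->
  ev (cleared_op p) (z *m map_mx intr (S a)) * ev disc_poly z =
  ev (cleared_op p) z * ev disc_poly (z *m map_mx intr (S a)).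
Proof.
move=> hp aD z0; rewrite !ev_cleared ?disc_refl_neq0 //.
suff -> : \sum_(eta <- X) coef_val eta (z *m map_mx intr (S a)) *
      ev p (z *m map_mx intr (S a) - inV C eta) =
    \sum_(eta <- X) coef_val eta z * ev p (z - inV C eta) by ring.
have pX := perm_map_stable (refl_inj_dual aD) (fun e => @hstX _ e aD).
rewrite -[RHS](perm_big _ pX).
rewrite big_map; apply: eq_bigr => eta _ /=.
rewrite coef_val_refl // -(hp a (z - _) aD) mulmxBl -inV_mul.
by rewrite -mulmxA refl_mxK ?mulmx1 ?hco.
Qed.

Lemma tau_regular a : a \in Dp -> evalV a (inV C tau) != 0.
Proof. by move/htau => h; rewrite evalV_inV intr_eq0 gt_eqF. Qed.

Lemma Dp_neq0 a : a \in Dp -> a != 0.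
Proof.
by move/htau; apply: contraTneq => ->; rewrite /pairing mulmx0 mxE ltxx.
Qed.

(* It suffices to see that [cleared_op p] vanishes on each root hyperplane.
   Since [cleared_op p / disc_poly] is invariant under the reflection while the
   denominator has a simple zero that changes sign, the value at a fixed point
   of the reflection is equal to its negative. *)
Lemma cleared_dvd p : refl_inv p -> exists q, disc_poly * q = cleared_op p.
Proof.
move=> hp; have [||a b aD bD|a aD|q ->] := @mpoly_prodlin_dvd C n Dp (cleared_op p).
- exact: fset_uniq.
- exact: Dp_neq0.
- exact: hnp.
- have aD' := half_sub hD aD.
  pose d' : {mpoly C[n]} := \prod_(b <- rem a Dp) lin C b.
  have dE : disc_poly = lin C a * d' by rewrite /disc_poly (big_rem a aD).
  (* The other roots may be multiplied in, as none of them vanishes identically on the hyperplane of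
     [a]. *)
  apply: (@hyperplane_prime_prod _ _ _ (rem a Dp)) => [b|z az].
    rewrite (mem_rem_uniq _ (fset_uniq _)) => /andP[ba bD].
    by apply: hnp => //; rewrite eq_sym.
  set M := map_mx intr (S a) : 'M[C]_n.
  (* The direction [tau] is transversal to every root hyperplane. *)
  pose zt (t : C) := z + t *: inV C tau.
  have ztM t : zt t *m M = z *m M + t *: (inV C tau *m M) by rewrite mulmxDl scalemxAl.
  have zM : z *m M = z by apply: refl_fixV.
  have pf q : polyfun (fun t => ev q (zt t)) by apply: polyfun_ev.
  have pfM q : polyfun (fun t => ev q (zt t *m M)).
    by apply: (polyfam_ext (fun t => congr1 (ev q) (esym (ztM t)))); apply: polyfun_ev.
  have [t1 ht1] := exists_regular z tau_regular.
  (* The invariance relation at regular points extends to the whole line. *)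
  have h1 := @polyfun_idomain _ _ (fun t =>
     ev (cleared_op p) (zt t *m M) * ev disc_poly (zt t) -
     ev (cleared_op p) (zt t) * ev disc_poly (zt t *m M)) _ (pf disc_poly) _ _ ht1.
  have {}h1 t : ev (cleared_op p) (zt t *m M) * ev disc_poly (zt t) -
     ev (cleared_op p) (zt t) * ev disc_poly (zt t *m M) = 0.
    apply: h1; first by apply: polyfamB; apply: polyfamM.
    move=> s; have [->|s0] := eqVneq (ev disc_poly (zt s)) 0; first by rewrite mul0r.
    by rewrite cleared_refl // subrr mulr0.
  (* Cancel from it the factor [a], equal to [t * a(tau)] on the line and sign-changing under the
     reflection. At [t = 0] the two summands coincide. *)
  have h2 := @polyfun_idomain _ (fun t => 0 + t * evalV a (inV C tau))
    (fun t => ev (cleared_op p) (zt t *m M) * ev d' (zt t) +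
     ev (cleared_op p) (zt t) * ev d' (zt t *m M)) 1 (polyfun_affine _ _) _ _ _ 0.
  have : ev (cleared_op p) (zt 0 *m M) * ev d' (zt 0) +
     ev (cleared_op p) (zt 0) * ev d' (zt 0 *m M) = 0.
    apply: h2; first by apply: polyfamD; apply: polyfamM.
      move=> t; rewrite -[RHS](h1 t) dE !evM !ev_lin -evalV_mul refl_root ?hco //.
      by rewrite evalV_opp /zt evalVD evalVZ az; ring.
    by rewrite add0r mul1r tau_regular.
  rewrite /zt scale0r addr0 zM -mulr2n => /eqP; rewrite mulrn_eq0 /= => /eqP e.
  rewrite mulrC -[RHS]e; congr (_ * _); rewrite ev_prod.
  by apply: eq_bigr => b _; rewrite ev_lin.
by exists q.
Qed.

(** At regular points this is [cleared_refl]; it extends to [z] along the line in the direction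
    [tau]. *)
Lemma cleared_quot_inv p q : refl_inv p -> disc_poly * q = cleared_op p -> refl_inv q.
Proof.
move=> hp hq a z aD; set M := map_mx intr (S a) : 'M[C]_n.
pose zt (t : C) := z + t *: inV C tau.
have ztM t : zt t *m M = z *m M + t *: (inV C tau *m M) by rewrite mulmxDl scalemxAl.
have [t1 ht1] := exists_regular z tau_regular.
have := @polyfun_idomain _ _ (fun t => ev q (zt t *m M) - ev q (zt t)) _
   (polyfun_ev disc_poly z (inV C tau)) _ _ ht1 0.
rewrite /zt scale0r addr0 => h; apply/eqP; rewrite -subr_eq0; apply/eqP; apply: h.
  apply: polyfamB; last exact: polyfun_ev.
  by apply: (polyfam_ext (fun t => congr1 (ev q) (esym (ztM t)))); apply: polyfun_ev.
move=> t; have [->|s0] := eqVneq (ev disc_poly (zt t)) 0; first by rewrite mul0r.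
have := cleared_refl hp aD s0; rewrite -hq !evM -/M => e.
have d0 := disc_refl_neq0 aD s0; rewrite -/M in d0.
apply: (mulfI d0); rewrite mulr0 -[RHS](subrr (ev disc_poly (zt t) * ev q (zt t) *
  ev disc_poly (zt t *m M))) -{1}e; ring.
Qed.

End Polynomiality.

(** * The root datum *)

Lemma mem_col_Sigma n (B : 'M[int]_n) i : col i B \in Sigma B.
Proof. exact: in_imfset. Qed.

Lemma mem_row_Sigma_dual n (B : 'M[int]_n) i : row i (invmx B) \in Sigma_dual B.
Proof. exact: in_imfset. Qed.

Lemma SigmaP n (B : 'M[int]_n) g : reflect (exists i, g = col i B) (g \in Sigma B).
Proof.
apply: (iffP idP) => [/imfsetP[i _ ->]|[i ->]]; first by exists i.
exact: mem_col_Sigma.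
Qed.

Lemma Sigma_dualP n (B : 'M[int]_n) eta :
  reflect (exists i, eta = row i (invmx B)) (eta \in Sigma_dual B).
Proof.
apply: (iffP idP) => [/imfsetP[i _ ->]|[i ->]]; first by exists i.
exact: mem_row_Sigma_dual.
Qed.

Lemma pairing_row n (g : 'cV[int]_n) (A : 'M[int]_n) i :
  pairing g (row i A) = (A *m g) i 0.
Proof. by rewrite /pairing -row_mul mxE. Qed.

Lemma pairing_col n (lam : 'rV[int]_n) (A : 'M[int]_n) i :
  pairing (col i A) lam = (lam *m A) 0 i.
Proof. by rewrite /pairing colE mulmxA -colE mxE. Qed.

Lemma pairing_sumr n (I : Type) (r : seq I) (P : pred I) g (F : I -> 'rV[int]_n) :
  pairing g (\sum_(i <- r | P i) F i) = \sum_(i <- r | P i) pairing g (F i).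
Proof. by rewrite /pairing mulmx_suml summxE. Qed.

Lemma pairing_suml n (I : Type) (r : seq I) (P : pred I) (F : I -> 'cV[int]_n) eta :
  pairing (\sum_(i <- r | P i) F i) eta = \sum_(i <- r | P i) pairing (F i) eta.
Proof. by rewrite /pairing mulmx_sumr summxE. Qed.

Definition tauZ n (B : 'M[int]_n) : 'rV[int]_n := \sum_i row i (invmx B).

Section Basis.
Variables (n : nat) (B : 'M[int]_n).
Hypothesis hB : B \in unitmx.

Lemma pairing_dual i j : pairing (col j B) (row i (invmx B)) = (i == j)%:R.
Proof. by rewrite pairing_row colE mulmxA mulVmx // mul1mx mxE andbT. Qed.

Lemma pairing_tau j : pairing (col j B) (tauZ B) = 1.
Proof.
rewrite pairing_sumr (bigD1 j) //= pairing_dual eqxx big1 ?addr0 // => i ij.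
by rewrite pairing_dual (negbTE ij).
Qed.

Lemma pairing_expand g lam :
  pairing g lam = \sum_i pairing (col i B) lam * pairing g (row i (invmx B)).
Proof.
have -> : pairing g lam = ((lam *m B) *m (invmx B *m g)) 0 0.
  by rewrite mulmxA mulmxK.
by rewrite mxE; apply: eq_bigr => i _; rewrite pairing_col pairing_row.
Qed.

Lemma nonnegP g :
  reflect (forall i, 0 <= pairing g (row i (invmx B))) (nonneg_on_dual B g).
Proof.
apply: (iffP allP) => [h i|h _ /Sigma_dualP[i ->]]; last exact: h.
exact/h/mem_row_Sigma_dual.
Qed.

Lemma row_invmx_inj : injective (fun i : 'I_n => row i (invmx B)).
Proof.
move=> i j e; have := pairing_dual i j; rewrite e pairing_dual eqxx.
by case: (i =P j).
Qed.

Lemma Lambda_plusP lam :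
  Lambda_plus B lam <-> forall i, 0 <= pairing (col i B) lam.
Proof.
split=> [[c ->] i|h].
  rewrite pairing_sumr big_seq sumr_ge0 // => _ /Sigma_dualP[j ->].
  rewrite /pairing -scaler_nat -scalemxAl mxE -/(pairing _ _).
  by rewrite pairing_dual mulr_ge0 ?ler0n.
exists (fun eta => \sum_(i | row i (invmx B) == eta) `|pairing (col i B) lam|)%N.
have p : perm_eq (Sigma_dual B) [seq row i (invmx B) | i <- index_enum 'I_n].
  apply: uniq_perm; first exact: fset_uniq.
    by rewrite map_inj_uniq ?index_enum_uniq //; apply: row_invmx_inj.
  move=> eta; apply/Sigma_dualP/mapP => [[i ->]|[i _ ->]]; exists i => //.
  exact: mem_index_enum.
rewrite (perm_big _ p) big_map /= -{1}[lam](mulmxK hB) mulmx_sum_row.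
apply: eq_bigr => i _; rewrite (big_pred1 i) => [|j]; last first.
  exact: (inj_eq row_invmx_inj).
by rewrite -pairing_col -scaler_nat natz gez0_abs.
Qed.

Lemma nonneg_pairing_ge0 g lam :
  nonneg_on_dual B g -> Lambda_plus B lam -> 0 <= pairing g lam.
Proof.
move=> /nonnegP hg /Lambda_plusP hl; rewrite pairing_expand sumr_ge0 // => i _.
by rewrite mulr_ge0.
Qed.

(** The pairing with [tau] is the sum of the coordinates of [g] in the basis [Sigma], which are not
    all zero. *)
Lemma nonneg_tau g : nonneg_on_dual B g -> g != 0 -> 0 < pairing g (tauZ B).
Proof.
move=> /nonnegP hg; rewrite lt_def pairing_sumr sumr_ge0 // andbT.
apply: contra; rewrite psumr_eq0 => [/allP h|i _]; last exact: hg.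
apply/eqP; rewrite -[g](mulKVmx hB); suff -> : invmx B *m g = 0 by rewrite mulmx0.
apply/colP => i; rewrite -pairing_row [RHS]mxE.
by apply/eqP/h; rewrite mem_index_enum.
Qed.

Lemma Lambda_plus_add a b :
  Lambda_plus B a -> Lambda_plus B b -> Lambda_plus B (a + b).
Proof.
move=> /Lambda_plusP ha /Lambda_plusP hb; apply/Lambda_plusP => i.
by rewrite pairingD addr_ge0.
Qed.

Lemma Lambda_plus_row i : Lambda_plus B (row i (invmx B)).
Proof. by apply/Lambda_plusP => j; rewrite pairing_dual ler0n. Qed.

Lemma Lambda_plus0 : Lambda_plus B 0.
Proof. by apply/Lambda_plusP => j; rewrite /pairing mul0mx mxE. Qed.

Lemma not_Lambda_plus lam :
  ~ Lambda_plus B lam -> exists i, pairing (col i B) lam < 0.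
Proof.
move=> h; have [/forallP h'|] := boolP [forall i, 0 <= pairing (col i B) lam].
  by case: h; apply/Lambda_plusP.
by rewrite negb_forall => /existsP[i hi]; exists i; rewrite ltNge.
Qed.

Lemma Lambda_plus_dec lam : Lambda_plus B lam \/ ~ Lambda_plus B lam.
Proof.
have [/forallP h|/negP h] := boolP [forall i, 0 <= pairing (col i B) lam].
  by left; apply/Lambda_plusP.
by right => /Lambda_plusP h'; apply: h; apply/forallP.
Qed.

End Basis.

(** * Positivity and counting of roots and weights *)

Section RootData.
Variables (n : nat) (B : 'M[int]_n) (W : {fset 'M[int]_n}) (ell : 'cV[int]_n).
Variables (Delta : {fset 'cV[int]_n}) (co : 'cV[int]_n -> 'rV[int]_n).
Hypotheses (hB : B \in unitmx) (hW : is_group W).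
Hypothesis hprim : forall a, a \in Delta -> primitive a.
Hypothesis hco : forall a, a \in Delta -> pairing a (co a) = 2.
Hypothesis hst : forall a b, a \in Delta -> b \in Delta ->
  refl_mx a (co a) *m b \in Delta.
Hypothesis hgen : generated_by W (fun s => exists2 a, a \in Delta &
  s = refl_mx a (co a)).
Hypotheses (hC2 : axiomC2 B Delta) (hC3 : axiomC3 B W) (hC4 : axiomC4 W ell).
Hypotheses (hC5 : axiomC5 B W Delta ell) (hC6 : axiomC6 B ell).
Hypothesis hC7 : axiomC7 B W Delta ell.

Local Notation Dp := (Delta_plus B Delta).
Local Notation tau := (tauZ B).
Local Notation S a := (refl_mx a (co a)).

Lemma W_unit w : w \in W -> w \in unitmx.
Proof. by case: hW => _ _ h _; apply: h. Qed.

Lemma W_inv w : w \in W -> invmx w \in W.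
Proof. by case: hW => _ _ _ h; apply: h. Qed.

Lemma W_mul v w : v \in W -> w \in W -> v *m w \in W.
Proof. by case: hW => _ h _ _; apply: h. Qed.

Lemma refl_in_W a : a \in Delta -> S a \in W.
Proof. by move=> aD; apply: hgen.1; exists a. Qed.

Lemma Delta_W w a : w \in W -> a \in Delta -> w *m a \in Delta.
Proof.
move=> /(hgen.2)[l hl ->] aD; elim: l hl => [|s l IH] hl.
  by rewrite big_nil mul1mx.
rewrite big_cons -mulmxA; have [b bD ->] := hl s (mem_head _ _).
by apply/hst/IH => // x xl; apply: hl; rewrite inE xl orbT.
Qed.

Lemma Phi_W w g : w \in W -> g \in Phi B W -> w *m g \in Phi B W.
Proof.
move=> wW /imfset2P[v vW [s sS ->]]; rewrite mulmxA.
by apply: in_imfset2 => //; apply: W_mul.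
Qed.

Lemma Sigma_Phi i : col i B \in Phi B W.
Proof.
rewrite -[col i B]mul1mx; apply: in_imfset2; last exact: mem_col_Sigma.
by case: hW.
Qed.

Lemma Lambda1P eta : eta \in Lambda1 B W ell -> exists w i,
  [/\ w \in W, row i (invmx B) \in Sigma1_dual B ell & eta = row i (invmx B) *m w].
Proof.
move=> /imfset2P[w wW [s sS ->]].
have := sS; rewrite !inE => /andP[/Sigma_dualP[i e] _].
by exists (invmx w), i; rewrite -e; split => //; apply: W_inv.
Qed.

Lemma Lambda1_W w eta : w \in W -> eta \in Lambda1 B W ell ->
  eta *m w \in Lambda1 B W ell.
Proof.
move=> wW /Lambda1P[v [i [vW sS ->]]]; rewrite -mulmxA -[v *m w]invmxK.
by apply: in_imfset2 => //; apply/W_inv/W_mul.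
Qed.

Lemma Sigma1_Lambda1 eta : eta \in Sigma1_dual B ell -> eta \in Lambda1 B W ell.
Proof.
move=> h; have -> : eta = act_dual 1%:M eta by rewrite /act_dual invmx1 mulmx1.
by apply: in_imfset2 => //; case: hW.
Qed.

Lemma ell_Lambda1 eta : eta \in Lambda1 B W ell -> pairing ell eta = 1.
Proof.
move=> /Lambda1P[w [i [wW + ->]]]; rewrite -pairing_mul hC4 //.
by rewrite !inE => /andP[_ /eqP].
Qed.

Lemma Lambda1_pairing eta g : eta \in Lambda1 B W ell ->
  g \in (Delta `|` Phi B W)%fset -> pairing g eta \in [:: -1; 0; 1].
Proof.
move=> /Lambda1P[w [i [wW sS ->]]] h; rewrite -pairing_mul; apply: hC7 => //.
move: h; rewrite !in_fsetU => /orP[h|h]; first by rewrite Delta_W.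
by rewrite Phi_W ?orbT.
Qed.

Lemma Lambda1_pairing_Delta eta a : eta \in Lambda1 B W ell -> a \in Delta ->
  pairing a eta \in [:: -1; 0; 1].
Proof. by move=> he aD; apply: Lambda1_pairing; rewrite // in_fsetU aD. Qed.

Lemma Lambda1_pairing_Phi eta g : eta \in Lambda1 B W ell -> g \in Phi B W ->
  pairing g eta \in [:: -1; 0; 1].
Proof. by move=> he aD; apply: Lambda1_pairing; rewrite // in_fsetU aD orbT. Qed.

Lemma Phi_pos g : g \in Phi B W -> nonneg_on_dual B g \/ nonneg_on_dual B (- g).
Proof.
move/(fsubsetP hC3); rewrite in_fsetU => /orP[|/imfsetP[h /= + ->]].
  by rewrite !inE => /andP[_]; left.
by rewrite !inE opprK => /andP[_]; right.
Qed.

Lemma Delta_half : Delta = (Dp `|` neg_set Dp)%fset.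
Proof. exact: hC2. Qed.

Lemma Delta_plus_nonneg a : a \in Dp -> nonneg_on_dual B a.
Proof. by rewrite !inE => /andP[]. Qed.

Lemma Delta_plus_sub a : a \in Dp -> a \in Delta.
Proof. by rewrite !inE => /andP[]. Qed.

Lemma Delta_neq0 a : a \in Delta -> a != 0.
Proof.
by move/hco => h; apply: contra_eq_neq h => ->; rewrite /pairing mulmx0 mxE.
Qed.

Lemma Delta_plus_tau a : a \in Dp -> 0 < pairing a tau.
Proof.
move=> aD; apply: nonneg_tau => //; first exact: Delta_plus_nonneg.
exact/Delta_neq0/Delta_plus_sub.
Qed.

Lemma Phi_neq0 g : g \in Phi B W -> g != 0.
Proof.
move=> /imfset2P[w wW [s /SigmaP[i ->] ->]]; apply/eqP => /(congr1 (mulmx (invmx w))).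
rewrite mulmx0 mulKmx ?W_unit // => /(congr1 (fun g => pairing g tau)).
by rewrite pairing_tau // /pairing mulmx0 mxE.
Qed.

Lemma Phi_tau g : g \in Phi B W ->
  if nonneg_on_dual B g then 1 <= pairing g tau else pairing g tau <= -1.
Proof.
move=> gP; have g0 := Phi_neq0 gP; case: ifP => [h|/negP h].
  have := nonneg_tau hB h g0; lia.
case: (Phi_pos gP) => // h'; have := nonneg_tau hB h'.
rewrite oppr_eq0 pairing_opp => /(_ g0); lia.
Qed.

(** If all 2 by 2 minors involving a nonzero entry of [a] vanish, both roots are integral multiples
    of one vector. Primitivity makes the multipliers 1 or -1, and opposite signs would make one root
    negative on [tau]. *)
Lemma Delta_plus_nonprop (C : numFieldType) a b :
  a \in Dp -> b \in Dp -> a != b -> nonprop C a b.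
Proof.
move=> aD bD ab.
have a0 := Delta_neq0 (Delta_plus_sub aD).
have [i ai] := cV_neq0_coord a0.
have [/existsP[j hj]|] := boolP [exists j, a i 0 * b j 0 != b i 0 * a j 0].
  exists ((a i 0)%:~R *: delta_mx 0 j - (a j 0)%:~R *: delta_mx 0 i).
  have e (g : 'cV[int]_n) k : evalV g (delta_mx 0 k) = (g k 0)%:~R :> C.
    by rewrite /evalV -rowE !mxE.
  rewrite !evalVB !evalVZ !e; split; first by rewrite mulrC subrr.
  by rewrite -!intrM -intrB intr_eq0 subr_eq0 [a j 0 * _]mulrC.
rewrite negb_exists => /forallP hp.
have {}hp j : a i 0 * b j 0 = b i 0 * a j 0.
  by apply/eqP; have := hp j; rewrite negbK.
(* The common vector is [u *: a + v *: b], and the multipliers [x], [y] are the [i]-th entries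
   divided by their gcd. *)
have [u [v]] := Bezoutz (a i 0) (b i 0).
set m := a i 0 in ai hp *; set k := b i 0 in hp *.
have g0 : gcdz m k != 0 by rewrite gcdz_eq0 (negbTE ai).
have := divzK (dvdz_gcdl m k); have := divzK (dvdz_gcdr m k).
set x := (m %/ _)%Z; set y := (k %/ _)%Z => ey ex huv.
have hxy : u * x + v * y = 1.
  by apply: (mulIf g0); rewrite mul1r -[RHS]huv mulrDl -!mulrA ex ey.
have {}hp j : x * b j 0 = y * a j 0.
  by apply: (mulIf g0); rewrite mulrAC ex hp mulrAC ey.
have ea : a = x *: (u *: a + v *: b).
  apply/colP => j; rewrite !mxE.
  have -> : x * (u * a j 0 + v * b j 0) = u * x * a j 0 + v * (x * b j 0) by ring.
  by rewrite hp mulrA -mulrDl hxy mul1r.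
have eb : b = y *: (u *: a + v *: b).
  apply/colP => j; rewrite !mxE.
  have -> : y * (u * a j 0 + v * b j 0) = u * (y * a j 0) + v * y * b j 0 by ring.
  by rewrite -hp mulrA -mulrDl hxy mul1r.
have x1 := hprim (Delta_plus_sub aD) ea.
have y1 := hprim (Delta_plus_sub bD) eb.
have := Delta_plus_tau aD; have := Delta_plus_tau bD.
move: ab (u *: a + v *: b) ea eb => ab c ea eb; move: ab; rewrite ea eb.
have [->|->] : x = 1 \/ x = -1 by lia.
  have [->|->] : y = 1 \/ y = -1 by lia.
    by rewrite eqxx.
  rewrite scale1r scaleN1r pairing_opp; lia.
have [->|->] : y = 1 \/ y = -1 by lia.
  rewrite scale1r scaleN1r pairing_opp; lia.
by rewrite eqxx.
Qed.

Lemma mulmx_W_inj w : w \in W -> injective (mulmx w : 'cV[int]_n -> 'cV_n).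
Proof.
move=> wW; apply: (can_inj (g := mulmx (invmx w))) => g.
by rewrite mulKmx ?W_unit.
Qed.

Lemma count_Phi_W w eta : w \in W ->
  count (fun g => 0 < pairing g (eta *m w)) (Phi B W) =
  count (fun g => 0 < pairing g eta) (Phi B W).
Proof.
move=> wW; have p := perm_map_stable (mulmx_W_inj wW) (fun g => @Phi_W _ g wW).
rewrite -[RHS](permP p) count_map; apply: eq_count => g /=.
by rewrite pairing_mul.
Qed.

Lemma count_Delta_W w eta : w \in W ->
  count (fun g => 0 < pairing g (eta *m w)) Delta =
  count (fun g => 0 < pairing g eta) Delta.
Proof.
move=> wW; have p := perm_map_stable (mulmx_W_inj wW) (fun g => @Delta_W _ g wW).
rewrite -[RHS](permP p) count_map; apply: eq_count => g /=.
by rewrite pairing_mul.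
Qed.

Lemma root_pos g : g \in (Delta `|` Phi B W)%fset ->
  nonneg_on_dual B g \/ nonneg_on_dual B (- g).
Proof.
rewrite in_fsetU => /orP[/(half_mem Delta_half)[]|/Phi_pos //].
  by move/Delta_plus_nonneg; left.
by move/Delta_plus_nonneg; right.
Qed.

(** By (C7) every pairing is -1, 0 or 1, and an element positive on [eta] is nonnegative on the
    whole dual basis. *)
Lemma sum_pairing_count (X : {fset 'cV[int]_n}) eta :
  eta \in Sigma1_dual B ell -> (forall g, g \in X -> g \in (Delta `|` Phi B W)%fset) ->
  \sum_(g <- [fset g in X | nonneg_on_dual B g]%fset) pairing g eta =
  (count (fun g => 0 < pairing g eta)%R X)%:Z.
Proof.
move=> he hX; rewrite -big_fset_condE /= -sum1_count -natz natr_sum.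
have := he; rewrite !inE => /andP[hs _].
rewrite big_mkcond [RHS]big_mkcond big_seq [RHS]big_seq.
apply: eq_bigr => g gX.
have := hC7 he (hX g gX); rewrite !inE.
case: (boolP (nonneg_on_dual B g)) => [/allP /(_ _ hs) /=|ng].
  by move=> p0 /or3P[] /eqP e; rewrite e in p0 *.
case: (root_pos (hX g gX)) => [h|/allP /(_ _ hs) /=]; first by rewrite h in ng.
by rewrite pairing_opp oppr_ge0; case: ltgtP.
Qed.

(** Evaluate (C5) at a vector of [Sigma1_dual], where [ell] is 1. Thus the numerator of [f_eta] has
    one factor more than its denominator. *)
Lemma count_Phi_Delta eta : eta \in Lambda1 B W ell ->
  count (fun g => 0 < pairing g eta)%R (Phi B W) =
  (count (fun g => 0 < pairing g eta)%R Delta).+1.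
Proof.
move=> /Lambda1P[w [i [wW hs ->]]]; rewrite count_Phi_W // count_Delta_W //.
have := congr1 (fun g => pairing g (row i (invmx B))) hC5.
have -> : pairing ell (row i (invmx B)) = 1 by move: hs; rewrite !inE => /andP[_ /eqP].
rewrite pairingBl !pairing_suml !sum_pairing_count // => [|a ha|g hg]; first by lia.
  by rewrite in_fsetU ha.
by rewrite in_fsetU hg orbT.
Qed.

Lemma Delta_plus_count eta : 
  (count (fun a => 0 < pairing a eta)%R Delta +
   count (fun a => pairing a eta == 0%R) Dp = size Dp)%N.
Proof. exact: half_count Delta_half Delta_plus_tau eta. Qed.

(** * The parameters [k_omega] *)

Section Kval.
Variable C : numFieldType.
Implicit Type rho : 'rV[C]_n.

Lemma pm_orbit_W w g : w \in W -> pm_orbit W (w *m g) = pm_orbit W g.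
Proof.
move=> wW.
have e : ([fset v *m (w *m g) | v in W] = [fset v *m g | v in W])%fset.
  apply/fsetP => h; apply/imfsetP/imfsetP => -[v /= vW ->].
    by exists (v *m w); rewrite ?mulmxA //=; apply: W_mul.
  exists (v *m invmx w); first by apply: W_mul => //; apply: W_inv.
  by rewrite mulmxA mulmxKV // W_unit.
have e' : ([fset - (v *m (w *m g)) | v in W] = [fset - (v *m g) | v in W])%fset.
  apply/fsetP => h; apply/imfsetP/imfsetP => -[v /= vW ->].
    by exists (v *m w); rewrite ?mulmxA //=; apply: W_mul.
  exists (v *m invmx w); first by apply: W_mul => //; apply: W_inv.
  by rewrite mulmxA mulmxKV // W_unit.
by rewrite /pm_orbit e e'.
Qed.

Lemma kval_W rho w g : w \in W -> kval B W rho (w *m g) = kval B W rho g.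
Proof. by move=> wW; rewrite /kval pm_orbit_W. Qed.

Lemma kval_line rho v (t : C) g :
  kval B W (rho + t *: v) g = kval B W rho g + t * kval B W v g.
Proof. by rewrite /kval; case: pickP => *; rewrite ?evalVD ?evalVZ ?mulr0 ?addr0. Qed.

Lemma kvalZ v (t : C) g : kval B W (t *: v) g = t * kval B W v g.
Proof. by rewrite /kval; case: pickP => *; rewrite ?evalVZ ?mulr0. Qed.

Lemma mem_pm_orbit g : g \in pm_orbit W g.
Proof.
rewrite in_fsetU; apply/orP; left; rewrite -{1}[g]mul1mx.
by apply: in_imfset; case: hW.
Qed.

Lemma kval_Sigma rho i : inV0 B W rho -> kval B W rho (col i B) = evalV (col i B) rho.
Proof.
move=> h; rewrite /kval; case: pickP => [j hj|/(_ i)]; last by rewrite mem_pm_orbit.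
by apply: h; rewrite ?mem_col_Sigma.
Qed.

Lemma kval_tau g : g \in Phi B W -> kval B W (inV C tau) g = 1.
Proof.
move=> /imfset2P[w wW [s /SigmaP[i ->] ->]]; rewrite kval_W // /kval.
case: pickP => [j _|/(_ i)]; last by rewrite mem_pm_orbit.
by rewrite evalV_inV pairing_tau.
Qed.

Lemma inV0_tau rho t : inV0 B W rho -> inV0 B W (rho + t *: inV C tau).
Proof.
move=> h g1 g2 h1 h2 h12; rewrite !evalVD !evalVZ (h _ _ h1 h2 h12).
move: h1 h2 => /SigmaP[i ->] /SigmaP[j ->].
by rewrite !evalV_inV !pairing_tau.
Qed.

End Kval.

(** Some coordinate of [mu - eta] is negative. Those of [mu] are nonnegative and those of [eta] at
    most 1, so there [mu] has 0 and [eta] has 1, and the factor of the numerator belonging to that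
    basis vector vanishes at [rho + mu]. *)
Lemma num_vanish (C : numFieldType) (rho : 'rV[C]_n) mu eta :
  inV0 B W rho -> eta \in Lambda1 B W ell -> Lambda_plus B mu ->
  ~ Lambda_plus B (mu - eta) ->
  exists i, [/\ pairing (col i B) eta = 1, pairing (col i B) mu = 0
     & evalV (col i B) (rho + inV C mu) = kval B W rho (col i B)].
Proof.
move=> hr he /(Lambda_plusP hB) hm /(not_Lambda_plus hB)[i hi].
have h1 := Lambda1_pairing_Phi he (Sigma_Phi i); have h0 := hm i.
rewrite pairingB in hi; rewrite !inE in h1.
have [e1 e0] : pairing (col i B) eta = 1 /\ pairing (col i B) mu = 0.
  case/or3P: h1 => /eqP; lia.
by exists i; split; rewrite // kval_Sigma // evalVD evalV_inV e0 addr0.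
Qed.

(** * The difference Euler operator *)

Section Operator.
Variable C : numFieldType.
Implicit Types (rho z : 'rV[C]_n) (p q : {mpoly C[n]}).

Local Notation Ph := (Phi B W).
Local Notation L1 := (Lambda1 B W ell).
Local Notation dl := (disc_poly C Dp).

(** The operator [L] multiplied by the discriminant. The polynomial [L p] is represented below by a
    [q] with [dl * q = clearedL rho p]. *)
Definition clearedL rho p : {mpoly C[n]} := cleared_op Dp Ph (kval B W rho) L1 p.

Lemma inv_refl p : invariant_poly W p -> refl_inv co Delta p.
Proof.
move=> h a z aD; have := h _ z (refl_in_W aD).
by rewrite /actV /actV_mx invmx_refl // hco.
Qed.

Lemma refl_inv_W p : refl_inv co Delta p -> invariant_poly W p.
Proof.
move=> h w z wW; rewrite /actV /actV_mx -!/(ev p _).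
have [l hl ->] := hgen.2 _ (W_inv wW).
elim: l hl z => [|s l IH] hl z; first by rewrite big_nil map_mx1 mulmx1.
rewrite big_cons map_mxM mulmxA IH => [|x xl]; last by apply: hl; rewrite inE xl orbT.
by have [a aD ->] := hl s (mem_head _ _); apply: h.
Qed.

Lemma clearedL_dvd rho p : invariant_poly W p ->
  exists q, dl * q = clearedL rho p /\ invariant_poly W q.
Proof.
move=> /inv_refl hp.
have hstP a g : a \in Delta -> g \in Ph -> S a *m g \in Ph.
  by move=> aD; apply/Phi_W/refl_in_W.
have hk a g : a \in Delta -> g \in Ph -> kval B W rho (S a *m g) = kval B W rho g.
  by move=> aD _; apply/kval_W/refl_in_W.
have hstX a eta : a \in Delta -> eta \in L1 -> eta *m S a \in L1.
  by move=> aD; apply/Lambda1_W/refl_in_W.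
have [q hq] := cleared_dvd hco hst Delta_half Delta_plus_tau
  (@Delta_plus_nonprop C) hstP hk hstX hp.
exists q; split=> //; apply: refl_inv_W.
exact: (cleared_quot_inv hco hst Delta_half Delta_plus_tau hstP hk hstX hp hq).
Qed.

Lemma Dp_seq_neq0 a : a \in enum_fset Dp -> a != 0.
Proof. by move=> aD; apply/Delta_neq0/Delta_plus_sub. Qed.

Lemma msize_disc : msize dl = (size Dp).+1.
Proof. exact: msize_prodlin Dp_seq_neq0. Qed.

Lemma disc_mpoly_neq0 : dl != 0.
Proof. by rewrite -msize_poly_eq0 msize_disc. Qed.

Lemma disc_cancel p q : dl * p = dl * q -> p = q.
Proof. exact: mulfI disc_mpoly_neq0 _ _. Qed.

Lemma msize_numB rho rho' eta :
  (msize (num_poly Ph (kval B W rho) eta - num_poly Ph (kval B W rho') eta)%R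
   <= count (fun g => 0 < pairing g eta)%R Ph)%N.
Proof.
apply: msize_prodB_leq => g; try exact: msize_linB.
set a := kval _ _ _ _; set b := kval _ _ _ _.
have -> : lin C g - a%:MP - (lin C g - b%:MP) = (b - a)%:MP by rewrite mpolyCB; ring.
exact: msizeC_leq.
Qed.

Lemma clearedL_split rho p :
  clearedL rho p = clearedL rho 1 * p +
   \sum_(eta <- L1)
      num_poly Ph (kval B W rho) eta * cof_poly C Dp eta * (shift eta p - p).
Proof.
rewrite big_distrl -big_split; apply: eq_bigr => eta _ /=.
by rewrite [shift eta 1]comp_mpoly1; ring.
Qed.

Lemma ell_ge1 i : 1 <= pairing ell (row i (invmx B)).
Proof. by have := hC6 (mem_row_Sigma_dual B i). Qed.

Lemma ell_Lambda_plus_ge lam i : Lambda_plus B lam ->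
  pairing (col i B) lam <= pairing ell lam.
Proof.
move=> /(Lambda_plusP hB) h; rewrite [leRHS](pairing_expand hB) (bigD1 i) //=.
rewrite -[leLHS]addr0 lerD ?sumr_ge0 // => [|j _]; last first.
  by rewrite mulr_ge0 // (le_trans _ (ell_ge1 j)).
by rewrite ler_peMr // ell_ge1.
Qed.

Lemma ell_Lambda_plus_ge0 lam : Lambda_plus B lam -> 0 <= pairing ell lam.
Proof.
move=> /(Lambda_plusP hB) h; rewrite (pairing_expand hB) sumr_ge0 // => j _.
by rewrite mulr_ge0 // (le_trans _ (ell_ge1 j)).
Qed.

Lemma Lambda_plus_inj lam mu :
  (forall i, pairing (col i B) lam = pairing (col i B) mu) -> lam = mu.
Proof.
move=> h; rewrite -[lam](mulmxK hB) -[mu](mulmxK hB); congr (_ *m _).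
by apply/rowP => i; rewrite -!pairing_col.
Qed.

Lemma Lambda_plus_ell0 lam : Lambda_plus B lam -> pairing ell lam = 0 -> lam = 0.
Proof.
move=> hl h0; apply: Lambda_plus_inj => i.
rewrite [RHS]/pairing mul0mx [RHS]mxE; apply/eqP.
by rewrite eq_le -{1}h0 ell_Lambda_plus_ge //= (Lambda_plusP hB _).1.
Qed.

Lemma num_ev0 rho mu eta : inV0 B W rho -> eta \in L1 -> Lambda_plus B mu ->
  ~ Lambda_plus B (mu - eta) ->
  ev (num_poly Ph (kval B W rho) eta) (rho + inV C mu) = 0.
Proof.
move=> hr he hm hn; have [i [h1 h0 hk]] := num_vanish hr he hm hn.
have p : 0 < pairing (col i B) eta by rewrite h1.
by rewrite ev_num (big_rem _ (Sigma_Phi i)) /= p hk subrr mul0r.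
Qed.

Lemma tau_Lambda_plus : Lambda_plus B tau.
Proof. by apply/(Lambda_plusP hB) => i; rewrite pairing_tau. Qed.

(** [a(mu)] is a nonnegative integer; were it positive, [a(rho) = - a(mu)] would contradict
    dominance. *)
Lemma dominant_pairing rho mu a : dominant B Delta rho -> a \in Dp ->
  Lambda_plus B mu -> evalV a (rho + inV C mu) = 0 ->
  evalV a rho = 0 /\ pairing a mu = 0.
Proof.
move=> hd aD hm; rewrite evalVD evalV_inV => /eqP; rewrite addr_eq0 => /eqP e.
have := nonneg_pairing_ge0 hB (Delta_plus_nonneg aD) hm.
rewrite le_eqVlt => /orP[/eqP e0|p].
  by split; rewrite // e -e0 mulr0z oppr0.
case: (hd a aD); exists (- pairing a mu); first by rewrite oppr_lt0.
by rewrite e rmorphN.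
Qed.

Lemma dominant_disc_tau rho : dominant B Delta rho -> ev dl (rho + inV C tau) != 0.
Proof.
move=> hd; rewrite ev_prod prodf_seq_neq0; apply/allP => a aD /=.
rewrite ev_lin; apply/eqP => e.
have [_ h] := dominant_pairing hd aD tau_Lambda_plus e.
by have := Delta_plus_tau aD; rewrite h.
Qed.

Lemma disc_tau_neq0 (t : C) v : 0 < t -> Lambda_plus B v ->
  ev dl (t *: inV C tau + inV C v) != 0.
Proof.
move=> t0 hv; rewrite ev_prod prodf_seq_neq0; apply/allP => a aD /=.
rewrite ev_lin evalVD evalVZ !evalV_inV gt_eqF //.
rewrite ltr_wpDr ?mulr_gt0 ?ltr0z ?Delta_plus_tau // ler0z.
exact: (nonneg_pairing_ge0 hB (Delta_plus_nonneg aD) hv).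
Qed.

Lemma inV0_0 : inV0 B W (0 : 'rV[C]_n).
Proof. by move=> *; rewrite /evalV !mul0mx mxE. Qed.

Lemma inV0_Ztau (t : C) : inV0 B W (t *: inV C tau).
Proof. by rewrite -[_ *: _]add0r; apply: inV0_tau inV0_0. Qed.

(** * The value of [L] on the constant 1 *)

Lemma invariant_poly1 : invariant_poly W (1 : {mpoly C[n]}).
Proof. by move=> *; rewrite !meval1. Qed.

Lemma count_Phi_roots eta : eta \in L1 ->
  (count (fun g => 0 < pairing g eta)%R Ph + count (fun a => pairing a eta == 0)%R Dp)%N
  = (size Dp).+1.
Proof. by move=> he; rewrite count_Phi_Delta // addSn Delta_plus_count. Qed.

Lemma msize_num_cof rho eta : eta \in L1 ->
  (msize (num_poly Ph (kval B W rho) eta * cof_poly C Dp eta) <= (size Dp).+2)%N.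
Proof.
move=> he; rewrite -(count_Phi_roots he).
apply: leq_trans (msizeM_leq (msize_num _ _ _) (msize_cof _ _ _)) _.
by rewrite addSn addnS.
Qed.

Lemma msize_numB_cof rho rho' eta : eta \in L1 ->
  (msize ((num_poly Ph (kval B W rho) eta - num_poly Ph (kval B W rho') eta)%R *
     cof_poly C Dp eta) <= (size Dp).+1)%N.
Proof.
move=> he; rewrite -(count_Phi_roots he).
by apply: leq_trans (msizeM_leq (msize_numB _ _ _) (msize_cof _ _ _)) _; rewrite addnS.
Qed.

Lemma clearedL1_sum rho :
  clearedL rho 1 = \sum_(eta <- L1) num_poly Ph (kval B W rho) eta * cof_poly C Dp eta.
Proof. by apply: eq_bigr => eta _; rewrite [shift eta 1]comp_mpoly1 mulr1. Qed.

(** Counting factors bounds the degree of [L 1] by 1. A change of [rho] affects the numerators only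
    in lower degree, so the linear part [f] does not depend on [rho] and is read off at
    [rho = 0]. *)
Lemma clearedL1_quot : exists f : {scalar 'rV[C]_n}, 
  (forall rho q, dl * q = clearedL rho 1 -> forall z, ev q z = f z + ev q 0) /\
  (forall w z, w \in W -> f (actV w z) = f z).
Proof.
have sz rho q : dl * q = clearedL rho 1 -> (msize q <= 2)%N.
  move=> hq; apply: (msize_mul_cancel msize_disc); rewrite hq clearedL1_sum addn2.
  by apply: msize_sum_leq => eta he _; apply: msize_num_cof.
have [q0 [hq0 inv0]] := clearedL_dvd 0 invariant_poly1.
have [f hf] := msize_leq2 (sz _ _ hq0); exists f.
split=> [rho q hq z|w z wW]; last first.
  have h : ev q0 (actV w z) = ev q0 z := inv0 w z wW.
  by move: h; rewrite hf [RHS]hf => /addIr.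
have s1 : (msize (q - q0) <= 1)%N.
  apply: (msize_mul_cancel msize_disc); rewrite mulrBr hq hq0 !clearedL1_sum addn1 -sumrB.
  apply: msize_sum_leq => eta he _; rewrite -mulrBl; exact: msize_numB_cof.
have e := msize1_polyC s1.
have : ev (q - q0) z = ev (q - q0) 0 by rewrite e !evC.
rewrite !evB hf => h; apply/eqP; rewrite -subr_eq0; apply/eqP.
rewrite -[RHS](subrr (ev q 0 - ev q0 0)) -{1}h; ring.
Qed.

Hypothesis hC8 : axiomC8 C B W ell.

(** Every [- eta] has level -1 and so lies outside [Lambda_plus]: all numerators vanish at the point
    [rho = t tau]. *)
Lemma clearedL1_tau t : 0 < t -> ev (clearedL (t *: inV C tau) 1) (t *: inV C tau) = 0.
Proof.
move=> t0; rewrite clearedL1_sum ev_sum big_seq big1 // => eta he.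
rewrite evM -{2}[t *: _]addr0 -[X in _ + X](map_mx0 (intr : {rmorphism int -> C})).
rewrite (num_ev0 (mu := 0)) ?mul0r //; [exact: inV0_Ztau|exact: Lambda_plus0|].
rewrite sub0r => /ell_Lambda_plus_ge0.
by rewrite -[- eta]sub0r pairingB (ell_Lambda1 he) /pairing mul0mx mxE.
Qed.

(** [eta0 - eta] has level 0, so it lies in [Lambda_plus] only for [eta = eta0]. *)
Lemma clearedL1_tau_eta t eta0 : 0 < t -> eta0 \in Sigma1_dual B ell ->
  ev (clearedL (t *: inV C tau) 1) (t *: inV C tau + inV C eta0) =
  ev (num_poly Ph (kval B W (t *: inV C tau)) eta0) (t *: inV C tau + inV C eta0) *
  ev (cof_poly C Dp eta0) (t *: inV C tau + inV C eta0).
Proof.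
move=> t0 h0; have h1 := Sigma1_Lambda1 h0.
have hl : Lambda_plus B eta0.
  by have := h0; rewrite !inE => /andP[/Sigma_dualP[i ->] _]; apply: Lambda_plus_row.
rewrite clearedL1_sum ev_sum (bigD1_seq eta0) ?fset_uniq //= evM.
rewrite big_seq_cond big1 ?addr0 //.
move=> eta /andP[he ne]; rewrite evM num_ev0 ?mul0r //; first exact: inV0_Ztau.
move=> hn; have := Lambda_plus_ell0 hn.
rewrite pairingB !ell_Lambda1 // subrr => /(_ erefl)/eqP.
by rewrite subr_eq0 eq_sym (negbTE ne).
Qed.

(** For [rho = t tau], [L 1] vanishes at [rho], so [f(eta0)] is its value at [rho + eta0], where
    only the coefficient of [eta0] contributes. Clearing denominators gives an identity polynomial
    in [t], valid at positive integers and hence at [t = 0], where both products are 1. *)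
Lemma linear_part_Sigma1 (f : {scalar 'rV[C]_n}) eta0 :
  (forall rho q, dl * q = clearedL rho 1 -> forall z, ev q z = f z + ev q 0) ->
  eta0 \in Sigma1_dual B ell -> f (inV C eta0) = 1.
Proof.
move=> hf h0; have h1 := Sigma1_Lambda1 h0.
have hl : Lambda_plus B eta0.
  by have := h0; rewrite !inE => /andP[/Sigma_dualP[i ->] _]; apply: Lambda_plus_row.
pose a (t : C) := f (inV C eta0) *
    (\prod_(b <- Delta | 0 < pairing b eta0) (1 + t * (pairing b tau)%:~R)) -
    \prod_(g <- Ph | 0 < pairing g eta0) (1 + t * ((pairing g tau)%:~R - 1)).
have pa : polyfun a.
  apply: polyfamB; first apply: polyfamM (polyfam_cst _ _) _.
    by apply: polyfam_prod => b; apply: polyfun_affine.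
  by apply: polyfam_prod => g; apply: polyfun_affine.
have a0 : a 0 = 0.
  apply: polyfun_nat pa _ 0 => k; pose t : C := k.+1%:R.
  have t0 : 0 < t by rewrite ltr0n.
  have [q [hq _]] := clearedL_dvd (t *: inV C tau) invariant_poly1.
  have e1 := clearedL1_tau t0; have e2 := clearedL1_tau_eta t0 h0.
  set z := t *: inV C tau in e1 e2 hq; set y := z + _ in e2.
  have z0 : ev dl z != 0.
    by have := disc_tau_neq0 t0 (Lambda_plus0 hB); rewrite /inV map_mx0 addr0.
  have y0 : ev dl y != 0 by apply: disc_tau_neq0.
  have qz : ev q z = 0.
    by apply: (mulfI z0); rewrite mulr0 -evM hq.
  have qy : ev q y = f (inV C eta0).
    have e3 := hf _ _ hq z; have e4 := hf _ _ hq y.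
    rewrite e4 linearD -addrA addrCA -e3 qz addr0 //.
  rewrite -hq evM qy -(den_cof C Delta_half Delta_plus_tau eta0) in e2.
  rewrite (evM (den_poly _ _ _)) in e2.
  have y0' := y0; rewrite -(den_cof C Delta_half Delta_plus_tau eta0) in y0'.
  rewrite (evM (den_poly _ _ _)) mulf_eq0 negb_or in y0'.
  case/andP: y0' => _ c0.
  have {}e2 : f (inV C eta0) * ev (den_poly C Delta eta0) y =
      ev (num_poly Ph (kval B W z) eta0) y.
    by apply: (mulIf c0); rewrite -e2; ring.
  rewrite /a -/t; apply/eqP; rewrite subr_eq0; apply/eqP.
  have -> : \prod_(b <- Delta | 0 < pairing b eta0) (1 + t * (pairing b tau)%:~R)
      = ev (den_poly C Delta eta0) y.
    rewrite ev_prod big_seq_cond [RHS]big_seq_cond; apply: eq_bigr => b /andP[bD p].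
    have := Lambda1_pairing_Delta h1 bD; rewrite !inE => hb.
    have pb : pairing b eta0 = 1 by case/or3P: hb => /eqP e; rewrite e in p *.
    by rewrite ev_lin evalVD evalVZ !evalV_inV pb addrC.
  rewrite e2 ev_num big_seq_cond [RHS]big_seq_cond; apply: eq_bigr => g /andP[gP p].
  have := Lambda1_pairing_Phi h1 gP; rewrite !inE => hb.
  have pb : pairing g eta0 = 1 by case/or3P: hb => /eqP e; rewrite e in p *.
  rewrite evalVD evalVZ !evalV_inV pb kvalZ kval_tau //; ring.
move: a0; rewrite /a !big1 => [|g _|b _]; try by rewrite mul0r addr0.
by rewrite mulr1 => /eqP; rewrite subr_eq0 => /eqP.
Qed.

Lemma evalV_linear : exists f : {scalar 'rV[C]_n}, forall z, f z = evalV ell z.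
Proof.
have lf : linear_for *%R (evalV ell : 'rV[C]_n -> C).
  by move=> a y z; rewrite evalVD evalVZ.
pose f : {scalar 'rV[C]_n} := HB.pack (evalV ell : 'rV[C]_n -> C)
  (GRing.isLinear.Build _ _ _ _ _ lf).
by exists f.
Qed.

(** The linear part and [ell] are invariant and both equal 1 on [Sigma1_dual]; (C8) identifies
    them. *)
Lemma clearedL1_quotE rho q z :
  dl * q = clearedL rho 1 -> ev q z = evalV ell z + ev q 0.
Proof.
move=> hq; have [f [hf finv]] := clearedL1_quot; have [g hg] := evalV_linear.
rewrite (hf _ _ hq); congr (_ + _); rewrite -hg; apply: hC8 => //.
  move=> w y wW; rewrite !hg /actV /actV_mx -evalV_mul hC4 //; exact: W_inv.
move=> eta he; rewrite hg evalV_inV (ell_Lambda1 (Sigma1_Lambda1 he)).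
exact: linear_part_Sigma1 hf he.
Qed.

Lemma polyfam_clearedL rho v p :
  polyfam (mpolyC n (R := C)) (fun t : C => clearedL (rho + t *: v) p).
Proof.
apply: polyfam_sum => eta; apply: polyfamM (polyfam_cst _ _).
apply: polyfamM (polyfam_cst _ _); apply: polyfam_prod => g.
apply: polyfam_ext (polyfamB (polyfam_cst _ (lin C g - (kval B W rho g)%:MP))
  (polyfamM (polyfam_id _) (polyfam_cst _ (kval B W v g)%:MP))) => t /=.
by rewrite kval_line mpolyCD mpolyCM opprD addrA.
Qed.

Lemma disc_tau1 : ev dl (inV C tau) != 0.
Proof.
have := disc_tau_neq0 (ltr01 : 0 < 1 :> C) (Lambda_plus0 hB).
by rewrite scale1r /inV map_mx0 addr0.
Qed.

(** For regular [rho] all numerators vanish at [rho], hence so does [L 1], which fixes its constant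
    term. In general, replace [rho] by [rho + t tau] and continue to [t = 0]. *)
Lemma clearedL1_value rho q z : inV0 B W rho -> dominant B Delta rho ->
  dl * q = clearedL rho 1 -> ev q z = evalV ell z - evalV ell rho.
Proof.
move=> hr hd hq; pose tC := inV C tau.
(* Up to the factor [ev dl tC], the error at the point [tau] of the claimed formula for the
   parameter [rho + t tau]; [t *: 0] only gives the point the shape required by [polyfam_ev]. *)
pose u (t : C) := ev (clearedL (rho + t *: tC) 1) (tC + t *: 0) -
   ev dl tC * (evalV ell tC - (evalV ell rho + t * evalV ell tC)).
have pu : polyfun u.
  apply: polyfamB; first exact/polyfam_ev/polyfam_clearedL.
  apply: polyfamM (polyfam_cst _ _) _.
  by apply: polyfamB (polyfam_cst _ _) (polyfun_affine _ _).
have d1 : ev dl (rho + 1 *: tC) != 0 by rewrite scale1r dominant_disc_tau.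
have u0 : u 0 = 0.
  apply: (polyfun_idomain (polyfun_ev dl rho tC) pu _ d1) => t.
  have [q' [hq' _]] := clearedL_dvd (rho + t *: tC) invariant_poly1.
  set r := rho + t *: tC in hq' *.
  have e : ev dl r * ev q' r = 0.
    rewrite -evM hq' clearedL1_sum ev_sum big_seq big1 // => eta he.
    rewrite evM -{2}[r]addr0 -[X in _ + X](map_mx0 (intr : {rmorphism int -> C})).
    rewrite (num_ev0 (mu := 0)) ?mul0r //; [exact: inV0_tau|exact: Lambda_plus0|].
    rewrite sub0r => /ell_Lambda_plus_ge0.
    by rewrite -[- eta]sub0r pairingB (ell_Lambda1 he) /pairing mul0mx mxE.
  rewrite /u -/r -hq' scaler0 addr0 evM -evalVZ -evalVD -/r (clearedL1_quotE tC hq').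
  rewrite (clearedL1_quotE r hq') in e.
  have -> : ev dl r * (ev dl tC * (evalV ell tC + ev q' 0) -
      ev dl tC * (evalV ell tC - evalV ell r)) =
    ev dl tC * (ev dl r * (evalV ell r + ev q' 0)) by ring.
  by rewrite e mulr0.
move: u0; rewrite /u !scale0r !addr0 mul0r addr0 -hq evM => /eqP.
rewrite -mulrBr mulf_eq0 (negbTE disc_tau1) /=.
rewrite (clearedL1_quotE tC hq) (clearedL1_quotE z hq).
by rewrite subr_eq0 => /eqP /addrI ->.
Qed.

(** * Cancellation of poles at [rho + mu] *)

Section Count.
Variables (rho : 'rV[C]_n) (mu : 'rV[int]_n).
Hypotheses (hr : inV0 B W rho) (hm : Lambda_plus B mu).

(** For dominant [rho], a positive root vanishing at [rho + mu] vanishes at [rho] and at [mu]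
    separately. Imposing both conditions makes this set and [vanishing_weights] stable under the
    reflections concerned. *)
Definition fixing_roots (X : {fset 'cV[int]_n}) : {fset 'cV[int]_n} :=
  [fset a in X | (pairing a mu == 0) && (evalV a rho == 0)]%fset.
Definition vanishing_weights : {fset 'cV[int]_n} :=
  [fset g in Ph | (pairing g mu == 0) && (evalV g rho == kval B W rho g)]%fset.

Local Notation D0 := (fixing_roots Delta).
Local Notation Dp0 := (fixing_roots Dp).
Local Notation P0 := vanishing_weights.
Local Notation cN eta := (count (fun g => 0 < pairing g eta)%R P0).
Local Notation cM eta := (count (fun g => 0 < pairing g eta)%R D0).

Lemma in_fixing X a : (a \in fixing_roots X) =
  [&& a \in X, pairing a mu == 0 & evalV a rho == 0].
Proof. by rewrite !inE. Qed.

Lemma in_vanishing g : (g \in P0) =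
  [&& g \in Ph, pairing g mu == 0 & evalV g rho == kval B W rho g].
Proof. by rewrite !inE. Qed.

Lemma fixing_rootsP X a : a \in fixing_roots X ->
  [/\ a \in X, pairing a mu = 0 & evalV a rho = 0].
Proof. by rewrite !inE => /andP[-> /andP[/eqP -> /eqP ->]]. Qed.

Lemma fixing_half : D0 = (Dp0 `|` neg_set Dp0)%fset.
Proof.
apply/fsetP => a; rewrite in_fsetU; apply/idP/orP => [h|[h|/imfsetP[b /= h ->]]].
- have [aD am ar] := fixing_rootsP h.
  case: (half_mem Delta_half aD) => h'; [left|right].
    by rewrite in_fixing h' am ar !eqxx.
  apply/imfsetP; exists (- a); rewrite ?opprK //=.
  by rewrite in_fixing h' pairing_opp evalV_opp am ar !oppr0 !eqxx.
- have [aD am ar] := fixing_rootsP h.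
  by rewrite in_fixing (Delta_plus_sub aD) am ar !eqxx.
have [bD bm br] := fixing_rootsP h.
rewrite in_fixing pairing_opp evalV_opp bm br !oppr0 !eqxx !andbT.
by rewrite -(refl_root (hco (Delta_plus_sub bD))) hst // Delta_plus_sub.
Qed.

Lemma fixing_tau a : a \in Dp0 -> 0 < pairing a tau.
Proof. by case/fixing_rootsP => aD _ _; apply: Delta_plus_tau. Qed.

Lemma fixing_stable a b : a \in D0 -> b \in D0 -> S a *m b \in D0.
Proof.
move=> /fixing_rootsP[aD am ar] /fixing_rootsP[bD bm br].
rewrite in_fixing hst //= pairing_mul refl_fix // bm eqxx.
by rewrite evalV_mul refl_fixV // br eqxx.
Qed.

Lemma vanishing_stable a g : a \in D0 -> g \in P0 -> S a *m g \in P0.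
Proof.
move=> /fixing_rootsP[aD am ar]; rewrite !in_vanishing => /and3P[gP /eqP gm /eqP gr].
have sW := refl_in_W aD.
rewrite Phi_W //= pairing_mul refl_fix // gm eqxx.
by rewrite evalV_mul refl_fixV // gr kval_W // eqxx.
Qed.

Lemma cN_refl a eta : a \in D0 -> cN (eta *m S a) = cN eta.
Proof.
move=> aD; have [aD' _ _] := fixing_rootsP aD.
have p := perm_map_stable (mulmx_W_inj (refl_in_W aD'))
  (fun g => @vanishing_stable _ g aD).
by rewrite -[RHS](permP p) count_map; apply: eq_count => g /=; rewrite pairing_mul.
Qed.

Lemma cM_refl a eta : a \in D0 -> cM (eta *m S a) = cM eta.
Proof.
move=> aD; have [aD' _ _] := fixing_rootsP aD.
have p := perm_map_stable (mulmx_W_inj (refl_in_W aD'))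
  (fun g => @fixing_stable _ g aD).
by rewrite -[RHS](permP p) count_map; apply: eq_count => g /=; rewrite pairing_mul.
Qed.

(* Otherwise the sum of the terms with the same excess of numerators over
   denominators, formed with the roots and weights through [rho + mu] only and
   with [rho] replaced by [tau] in the numerators, would be a polynomial of negative
   degree; but at [tau] its summands all have the same sign. *)
Lemma fixing_le_vanishing eta :
  eta \in L1 -> Lambda_plus B (mu - eta) -> (cM eta <= cN eta)%N.
Proof.
move=> he hS; rewrite leqNgt; apply/negP => lt.
(* The terms with the same excess as [eta]; the reflections in [D0] preserve both counts, hence
   [X]. *)
pose X := [fset e in L1 | (cN e + cM eta == cN eta + cM e)%N]%fset.
have inX e : (e \in X) = (e \in L1) && (cN e + cM eta == cN eta + cM e)%N.
  by rewrite !inE.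
have XP e : e \in X -> e \in L1 /\ (cN e + cM eta = cN eta + cM e)%N.
  by rewrite inX => /andP[-> /eqP].
have hstX a e : a \in D0 -> e \in X -> e *m S a \in X.
  move=> aD /XP[e1 e2]; have [aD' _ _] := fixing_rootsP aD.
  by rewrite inX Lambda1_W ?refl_in_W // cN_refl // cM_refl // e2 eqxx.
have hco0 a : a \in D0 -> pairing a (co a) = 2 by case/fixing_rootsP => /hco.
have hnp a b : a \in Dp0 -> b \in Dp0 -> a != b -> nonprop C a b.
  by move=> /fixing_rootsP[h1 _ _] /fixing_rootsP[h2 _ _]; apply: Delta_plus_nonprop.
(* These are the values of [k_omega] for [tau], by [kval_tau]. *)
pose k1 : 'cV[int]_n -> C := fun=> 1.
pose G := cleared_op Dp0 P0 k1 X 1.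
have [q hq] := cleared_dvd hco0 fixing_stable fixing_half fixing_tau hnp
  vanishing_stable (fun a g _ _ => erefl : k1 (S a *m g) = k1 g) hstX
  (fun a z _ => etrans (ev1 _) (esym (ev1 _))).
have GE : G = \sum_(e <- X) num_poly P0 k1 e * cof_poly C Dp0 e.
  by apply: eq_bigr => e _; rewrite [shift e 1]comp_mpoly1 mulr1.
have cDp0 e : (cM e + count (fun a => pairing a e == 0)%R Dp0 = size Dp0)%N.
  exact: half_count fixing_half fixing_tau e.
have sd : msize (disc_poly C Dp0) = (size Dp0).+1.
  apply: msize_prodlin => a /fixing_rootsP[aD _ _].
  exact/Delta_neq0/Delta_plus_sub.
(* Each term has degree at most [size Dp0 + cN e - cM e], less than the degree [size Dp0] of the
   discriminant. *)
have q0 : q = 0.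
  apply/eqP; rewrite -msize_poly_eq0 -leqn0; apply: (msize_mul_cancel sd).
  rewrite hq -/G GE addn0; apply: msize_sum_leq => e /XP[_ h] _.
  apply: leq_trans (msizeM_leq (msize_num _ _ _) (msize_cof _ _ _)) _.
  rewrite -(cDp0 e) addSn /= addnS; lia.
have : ev G (inV C tau) * (-1) ^+ (cN eta + cM eta) = 0.
  by rewrite /G -hq q0 mulr0 ev0 mul0r.
rewrite GE ev_sum big_distrl /= => /eqP; rewrite big_seq_cond.
(* A term with [mu - e] outside [Lambda_plus] has a factor that is zero at [tau], by [num_vanish];
   the others have the common sign given by the parity of [cN eta + cM eta]. *)
have key e : e \in X -> if [forall i, 0 <= pairing (col i B) (mu - e)]
   then is_true (0 < ev (num_poly P0 k1 e * cof_poly C Dp0 e) (inV C tau) *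
      (-1) ^+ (cN eta + cM eta))
   else ev (num_poly P0 k1 e * cof_poly C Dp0 e) (inV C tau) = 0.
  move=> /XP[e1 e2].
  case: ifP => [/forallP /(Lambda_plusP hB) hl|/forallP hl]; last first.
    have hl' : ~ Lambda_plus B (mu - e) by move/(Lambda_plusP hB).
    have [i [i1 i2 i3]] := num_vanish hr e1 hm hl'.
    have iP : col i B \in P0.
      by rewrite in_vanishing Sigma_Phi i2 eqxx /= -i3 evalVD evalV_inV i2 addr0.
    rewrite evM ev_num (big_rem _ iP) /= i1 /=.
    by rewrite evalV_inV pairing_tau // subrr !mul0r.
  have -> : (-1) ^+ (cN eta + cM eta) = (-1) ^+ (cN e) * (-1) ^+ (cM e) :> C.
    rewrite -exprD -signr_odd -[RHS]signr_odd; congr (_ ^+ nat_of_bool _).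
    have := congr1 odd e2; rewrite !oddD.
    by case: (odd _) (odd _) (odd _) (odd _) => [] [] [] [].
  rewrite evM mulrACA ev_num prod_sign; apply: mulr_gt0.
    (* As [g(mu) = 0] and [g(e) > 0], [g] is negative on [mu - e], so it is a negative weight and
       [1 - g(tau) > 0]. *)
    rewrite big_seq_cond; apply: prodr_gt0 => g /andP[].
    rewrite in_vanishing => /and3P[gP /eqP gm _] p.
    have := Phi_tau gP; case: ifP => [h|_ h].
      by have := nonneg_pairing_ge0 hB h hl; rewrite pairingB gm sub0r; lia.
    by rewrite evalV_inV opprB subr_gt0 ltrz1; lia.
  have cL a : a \in Dp0 -> pairing a e <= 0.
    case/fixing_rootsP => aD am _.
    have := nonneg_pairing_ge0 hB (Delta_plus_nonneg aD) hl.
    by rewrite pairingB am sub0r oppr_ge0.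
  have cMe : cM e = count (fun a => pairing a e < 0)%R Dp0.
    have := cDp0 e; rewrite -(count_predC (fun a => pairing a e == 0)%R Dp0).
    rewrite addnC => /addnI ->.
    apply: eq_in_count => a aD /=; have := cL a aD; case: ltgtP => //.
  rewrite cMe evM !ev_prod mulrAC; apply: mulr_gt0.
    under eq_bigr do rewrite evN ev1.
    by rewrite prod_sign big1 // => a _; rewrite opprK.
  rewrite big_seq_cond; apply: prodr_gt0 => a /andP[aD _].
  by rewrite ev_lin evalV_inV ltr0z fixing_tau.
have etaX : eta \in X by rewrite inX he addnC eqxx.
rewrite -big_seq_cond (bigD1_seq eta) ?fset_uniq //= big_seq_cond => /eqP.
have := key eta etaX; case: ifP => [_ lt0|/forallP[]]; last exact/(Lambda_plusP hB).
apply/eqP; rewrite gt_eqF // ltr_wpDr // sumr_ge0 // => e /andP[eX _].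
by have := key e eX; case: ifP => [_ /ltW //|_ ->]; rewrite mul0r.
Qed.
End Count.

(* [rho] need not be regular: then [f_eta] may have a pole at [rho + mu].  Moving
   [rho] to [rho + t tau] makes every point regular for generic [t], and
   [fixing_le_vanishing] shows that the coefficients with [mu - eta] in [Lambda_plus]
   have a limit at [t = 0], the others being identically zero. *)
Lemma clearedL_quot_eq0 rho p q mu : inV0 B W rho -> dominant B Delta rho ->
  invariant_poly W p -> dl * q = clearedL rho p -> Lambda_plus B mu ->
  (forall eta, eta \in L1 -> Lambda_plus B (mu - eta) ->
     ev p (rho + inV C (mu - eta)) = 0) ->
  ev q (rho + inV C mu) = 0.
Proof.
move=> hr hd hp hq hm h0; pose tC := inV C tau.
(* [Q t] is [L p] for the parameter [rho + t tau]. *)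
have [|||t||Q pQ hQ] := @polyfam_quot C n Dp (fun t => clearedL (rho + t *: tC) p).
- exact: fset_uniq.
- exact: Dp_seq_neq0.
- exact: Delta_plus_nonprop.
- by have [q' [? _]] := clearedL_dvd (rho + t *: tC) hp; exists q'.
- exact: polyfam_clearedL.
pose z (t : C) := rho + inV C mu + t *: tC.
have zE t : z t = rho + t *: tC + inV C mu by rewrite /z addrAC.
have Q0 : Q 0 = q.
  apply: disc_cancel; rewrite hq -[dl * _]/(\prod_(a <- Dp) lin C a * _) hQ.
  by rewrite scale0r addr0.
rewrite -Q0 -[_ + inV C mu]addr0 -[X in _ + X](scale0r tC).
(* Values at [rho + mu] and slopes in the direction [tau]. [M0] is the order of vanishing of the
   discriminant at [t = 0] and [U] the remaining factor; [Z] and [Z'] below bound from below the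
   orders of numerator and cofactor. *)
pose A a := evalV a (rho + inV C mu); pose Tt a := evalV a tC.
pose U t := \prod_(a <- Dp) (if A a == 0 then Tt a else A a + t * Tt a).
pose M0 := count (fun a => A a == 0) Dp.
have dlE t : ev dl (z t) = t ^+ M0 * U t.
  transitivity (\prod_(a <- Dp) (A a + t * Tt a)); last exact: prod_affine.
  by rewrite ev_prod; apply: eq_bigr => a _; rewrite ev_lin evalVD evalVZ.
have fixE a : a \in Dp -> (A a == 0) = (a \in fixing_roots rho mu Dp).
  move=> aD; rewrite in_fixing aD /=; apply/eqP/andP => [e|[/eqP e1 /eqP e2]].
    by have [-> ->] := dominant_pairing hd aD hm e.
  by rewrite /A evalVD evalV_inV e1 e2 addr0.
pose Nw g := A g - kval B W rho g; pose Kw g := Tt g - kval B W tC g.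
pose Z eta := count (fun g => (0 < pairing g eta) && (Nw g == 0)) Ph.
pose Z' eta := count (fun a => (pairing a eta == 0) && (A a == 0)) Dp.
have numE eta t : ev (num_poly Ph (kval B W (rho + t *: tC)) eta) (z t) =
   t ^+ Z eta * \prod_(g <- Ph | 0 < pairing g eta)
     (if Nw g == 0 then Kw g else Nw g + t * Kw g).
  rewrite ev_num -prod_affine; apply: eq_bigr => g _.
  by rewrite kval_line evalVD evalVZ /Nw /Kw -/(A g) -/(Tt g); ring.
have cofE eta t : ev (cof_poly C Dp eta) (z t) =
   ev (\prod_(a <- Dp | pairing a eta < 0) (-1) : {mpoly C[n]}) (z t) *
   (t ^+ Z' eta * \prod_(a <- Dp | pairing a eta == 0)
     (if A a == 0 then Tt a else A a + t * Tt a)).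
  rewrite evM -prod_affine; congr (_ * _); rewrite ev_prod.
  by apply: eq_bigr => a _; rewrite ev_lin evalVD evalVZ.
have leZ eta : eta \in L1 -> Lambda_plus B (mu - eta) -> (M0 <= Z eta + Z' eta)%N.
  move=> he hS; have := fixing_le_vanishing hr hm he hS.
  have := half_count (fixing_half rho mu) (@fixing_tau rho mu) eta.
  set c1 := count _ _; set c2 := count _ _; set c3 := size _.
  set c4 := count _ _ => e le.
  have eM : M0 = c3.
    rewrite /c3 -count_predT /fixing_roots count_fset_filter /M0.
    apply: eq_in_count => a aD /=; rewrite fixE // in_fixing andbT.
    by rewrite aD.
  have eZ : Z' eta = c2.
    rewrite /c2 /fixing_roots count_fset_filter; apply: eq_in_count => a aD /=.
    by rewrite fixE // in_fixing aD /= andbC.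
  have eN : (c4 <= Z eta)%N.
    rewrite /c4 /vanishing_weights count_fset_filter; apply: sub_count => g /=.
    move=> /andP[/andP[/eqP gm /eqP gr] ->].
    by rewrite /Nw /A evalVD evalV_inV gm gr addr0 subrr eqxx.
  by rewrite eM eZ -e leq_add2r (leq_trans le eN).
pose b eta := [forall i, 0 <= pairing (col i B) (mu - eta)].
have bP eta : reflect (Lambda_plus B (mu - eta)) (b eta).
  by apply: (iffP forallP) => /(Lambda_plusP hB).
pose s eta : {mpoly C[n]} := \prod_(a <- Dp | pairing a eta < 0) (-1).
pose w eta := rho + inV C mu - inV C eta.
(* The term of [eta] divided by [t ^+ M0]; by [leZ] the exponent is not truncated. *)
pose h eta t := t ^+ (Z eta + Z' eta - M0) *
  (\prod_(g <- Ph | 0 < pairing g eta) (if Nw g == 0 then Kw g else Nw g + t * Kw g) *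
   (ev (s eta) (rho + inV C mu + t *: tC) *
    (\prod_(a <- Dp | pairing a eta == 0)
      (if A a == 0 then Tt a else A a + t * Tt a) * ev p (w eta + t *: tC)))).
pose V t := U t * ev (Q t) (z t) - \sum_(eta <- L1 | b eta) h eta t.
have pV : polyfun V.
  apply: polyfamB; first apply: polyfamM; first exact: polyfun_prod_affine.
    exact: polyfam_ev.
  apply: polyfam_sum => eta; apply: polyfamM; first exact: polyfunXn.
  apply: polyfamM; first exact: polyfun_prod_affine.
  apply: polyfamM; first exact: polyfun_ev.
  by apply: polyfamM; [exact: polyfun_prod_affine|exact: polyfun_ev].
(* The relation multiplied by [t ^+ M0] holds for all [t]; by continuation the power can be
   cancelled also at [t = 0]. *)
have V0 : V 0 = 0.
  apply: (polyfun_idomain (polyfunXn C M0) pV _ (t1 := 1)); last first.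
    by rewrite expr1n oner_eq0.
  move=> t; rewrite /V mulrBr mulrA -dlE -evM.
  rewrite -[dl * _]/(\prod_(a <- Dp) lin C a * _) hQ ev_sum.
  apply/eqP; rewrite subr_eq0; apply/eqP.
  rewrite big_distrr [RHS]big_mkcond big_seq [RHS]big_seq; apply: eq_bigr => eta he.
  rewrite (evM (num_poly _ _ _ * _)) (evM (num_poly _ _ _)) ev_shift.
  case: bP => [hS|hS]; last first.
    by rewrite zE num_ev0 ?mul0r //; apply: inV0_tau.
  rewrite numE cofE -/(s eta) /h.
  have -> : z t - inV C eta = w eta + t *: tC by rewrite /z /w addrAC.
  have : t ^+ M0 * t ^+ (Z eta + Z' eta - M0) = t ^+ Z eta * t ^+ Z' eta.
    by rewrite -!exprD subnKC // leZ.
  move: (t ^+ M0) (t ^+ (_ - _)) (t ^+ Z eta) (t ^+ Z' eta) => m d x y e.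
  rewrite [RHS]mulrA e -/(z t); ring.
move: V0; rewrite /V big1_seq ?subr0 => [|eta /andP[/bP hS he]]; last first.
  rewrite /h; have -> : w eta + 0 *: tC = rho + inV C (mu - eta).
    by rewrite scale0r addr0 inVB addrA.
  by rewrite h0 // !mulr0.
(* [U 0] is nonzero: its factors are nonzero values [A a] or slopes [Tt a]. *)
move=> /eqP; rewrite mulf_eq0 => /orP[|/eqP]; last by rewrite /z scale0r addr0.
rewrite /U prodf_seq_eq0 => /hasP[a aD]; case: ifP => [_|/negbT nA] /=.
  by rewrite (negbTE (tau_regular C Delta_plus_tau aD)).
by rewrite mul0r addr0 (negbTE nA).
Qed.

(** * Effect of [E] on the degree *)

(** By [clearedL1_value] the terms without differences, [ell * p - L 1 * p], amount to
    [ell(rho) * p]. *)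
Lemma clearedL_quot_euler rho p q : inV0 B W rho -> dominant B Delta rho ->
  dl * q = clearedL rho p ->
  dl * (lin C ell * p - q - evalV ell rho *: p) =
  - \sum_(eta <- L1)
      num_poly Ph (kval B W rho) eta * cof_poly C Dp eta * (shift eta p - p).
Proof.
move=> hr hd hq; have [q1 [hq1 _]] := clearedL_dvd rho invariant_poly1.
have e1 : q1 = lin C ell - (evalV ell rho)%:MP.
  apply: mpoly_ev_inj => z.
  by rewrite (clearedL1_value z hr hd hq1) evB ev_lin evC.
have := clearedL_split rho p; rewrite -hq -hq1 e1 -mul_mpolyC.
set R := \sum_(_ <- _) _ => e; rewrite !mulrBr e; ring.
Qed.

(** A coefficient raises the degree by at most 1 and the difference [shift eta p - p] lowers it. In
    [msize_eulerB] one more degree is lost, the numerators having the same leading part. *)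
Lemma msize_euler rho p q : inV0 B W rho -> dominant B Delta rho ->
  dl * q = clearedL rho p ->
  (msize (lin C ell * p - q - evalV ell rho *: p)%R <= msize p)%N.
Proof.
move=> hr hd hq; have [p0|p0] := eqVneq p 0.
  have q0 : q = 0.
    apply: disc_cancel; rewrite hq mulr0 /clearedL /cleared_op big1 // => eta _.
    by rewrite p0 /shift comp_mpoly0 mulr0.
  by rewrite p0 q0 mulr0 scaler0 !subr0.
apply: (msize_mul_cancel msize_disc); rewrite (clearedL_quot_euler hr hd hq) msizeN.
apply: msize_sum_leq => eta he _.
apply: leq_trans (msizeM_leq (msize_num_cof rho he) (msize_shiftB eta p)) _.
by rewrite addSn /= addSn -addnS prednK // lt0n msize_poly_eq0.
Qed.

Lemma msize_eulerB rho rho' p q q' :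
  inV0 B W rho -> dominant B Delta rho -> dl * q = clearedL rho p ->
  inV0 B W rho' -> dominant B Delta rho' -> dl * q' = clearedL rho' p ->
  (msize ((lin C ell * p - q - evalV ell rho *: p) -
          (lin C ell * p - q' - evalV ell rho' *: p))%R <= (msize p).-1)%N.
Proof.
move=> hr hd hq hr' hd' hq'; apply: (msize_mul_cancel msize_disc).
rewrite mulrBr (clearedL_quot_euler hr hd hq) (clearedL_quot_euler hr' hd' hq').
rewrite -opprB msizeN opprK addrC -sumrB; apply: msize_sum_leq => eta he _.
rewrite -mulrBl -mulrBl.
have := msizeM_leq (msize_numB_cof rho rho' he) (msize_shiftB eta p).
by rewrite addSn.
Qed.

Lemma clearedL_sum rho (I : Type) (s : seq I) (c : I -> C) (p : I -> {mpoly C[n]}) :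
  clearedL rho (\sum_(i <- s) c i *: p i) = \sum_(i <- s) c i *: clearedL rho (p i).
Proof.
rewrite /clearedL /cleared_op.
have e eta : shift eta (\sum_(i <- s) c i *: p i) = \sum_(i <- s) c i *: shift eta (p i).
  rewrite /shift raddf_sum /=; apply: eq_bigr => i _; exact: comp_mpolyZ.
under eq_bigr do rewrite e big_distrr.
rewrite exchange_big; apply: eq_bigr => i _ /=.
by rewrite scaler_sumr; apply: eq_bigr => eta _; rewrite scalerAr.
Qed.

(** In affine coordinates with origin [rho] and axes along the dual basis, [Lambda_plus] is the set
    of points with natural coordinates. *)
Lemma lattice_dense rho q :
  (forall mu, Lambda_plus B mu -> ev q (rho + inV C mu) = 0) -> q = 0.
Proof.
move=> h; pose M : 'M[C]_n := map_mx intr (invmx B).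
pose phi : n.-tuple {mpoly C[n]} :=
  [tuple (rho 0 j)%:MP + \sum_i M i j *: 'X_i | j < n].
have e (c : 'I_n -> C) : (q \mPo phi).@[c] = ev q (rho + (\row_i c i) *m M).
  rewrite comp_mpoly_meval /ev; apply: meval_eq => j.
  rewrite tnth_mktuple mevalD mevalC [in RHS]mxE; congr (_ + _).
  rewrite raddf_sum [RHS]mxE /=; apply: eq_bigr => i _.
  by rewrite mevalZ mevalXU mxE mulrC.
have q0 : q \mPo phi = 0.
  apply: mpoly_eq0_nat => c; rewrite e.
  rewrite -[RHS](h ((\row_i (c i)%:Z) *m invmx B)).
    congr (ev q (rho + _)); rewrite /inV map_mxM; congr (_ *m _).
    by apply/rowP => i; rewrite !mxE.
  apply/(Lambda_plusP hB) => i; rewrite pairing_col mulmxKV //.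
  by rewrite mxE.
apply: mpoly_ev_eq0 => z.
have := e (fun i => ((z - rho) *m map_mx intr B) 0 i).
have -> : \row_i ((z - rho) *m map_mx intr B) 0 i = (z - rho) *m map_mx intr B.
  by apply/rowP => i; rewrite mxE.
rewrite q0 meval0 -mulmxA -map_mxM mulmxV // map_mx1 mulmx1.
by rewrite addrC subrK => <-.
Qed.

(** Coordinates up to [d] suffice, because [ell] is at least 1 on the dual basis. *)
Definition level (d : nat) : seq 'rV[int]_n :=
  undup [seq lam <- [seq (\row_i (f i : nat)%:Z) *m invmx B
                        | f : {ffun 'I_n -> 'I_d.+1}]
        | pairing ell lam <= d%:Z].

Lemma levelP d lam :
  reflect (Lambda_plus B lam /\ pairing ell lam <= d%:Z) (lam \in level d).
Proof.
rewrite mem_undup mem_filter; apply: (iffP andP) => [[h /mapP[f _ e]]|[hl h]].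
  split=> //; apply/(Lambda_plusP hB) => i.
  by rewrite e pairing_col mulmxKV // mxE.
split=> //; apply/mapP; exists [ffun i => inord `|pairing (col i B) lam|%N].
  by rewrite mem_enum.
rewrite -[LHS](mulmxK hB); congr (_ *m _); apply/rowP => i.
rewrite -pairing_col !mxE ffunE inordK.
  by rewrite gez0_abs // (Lambda_plusP hB _).1.
have := ell_Lambda_plus_ge i hl; have := (Lambda_plusP hB _).1 hl i; lia.
Qed.

Lemma level_uniq d : uniq (level d).
Proof. exact: undup_uniq. Qed.

(** * Interpolation *)

Definition vanishes_upto rho (k : nat) q := forall mu, Lambda_plus B mu ->
  pairing ell mu < k%:Z -> ev q (rho + inV C mu) = 0.

(** Both bounds are strict: degree below [k] and zeros at the levels below [k]. *)
Definition interp_inj rho := forall k q, invariant_poly W q ->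
  (msize q <= k)%N -> vanishes_upto rho k q -> q = 0.

Definition interp_poly rho lam q := [/\ invariant_poly W q,
  deg_le q (pairing ell lam) & delta_values B ell rho lam q].

Lemma invariant_polyD p q :
  invariant_poly W p -> invariant_poly W q -> invariant_poly W (p + q).
Proof. by move=> hp hq w z wW; rewrite !mevalD hp ?hq. Qed.

Lemma invariant_polyN p : invariant_poly W p -> invariant_poly W (- p).
Proof. by move=> hp w z wW; rewrite !mevalN hp. Qed.

Lemma invariant_polyZ c p : invariant_poly W p -> invariant_poly W (c *: p).
Proof. by move=> hp w z wW; rewrite !mevalZ hp. Qed.

Lemma invariant_poly_sum (I : eqType) (s : seq I) (F : I -> {mpoly C[n]}) :
  (forall i, i \in s -> invariant_poly W (F i)) ->
  invariant_poly W (\sum_(i <- s) F i).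
Proof.
move=> h; rewrite big_seq; apply: (big_ind (invariant_poly W)) => //.
  by move=> w z _; rewrite !meval0.
exact: invariant_polyD.
Qed.

Lemma invariant_lin_ell : invariant_poly W (lin C ell).
Proof.
move=> w z wW; rewrite -!/(ev (lin C ell) _) !ev_lin /actV /actV_mx -evalV_mul hC4 //.
exact: W_inv.
Qed.

Lemma invariant_polyM p q :
  invariant_poly W p -> invariant_poly W q -> invariant_poly W (p * q).
Proof. by move=> hp hq w z wW; rewrite !mevalM hp ?hq. Qed.

Lemma deg_le_msize q lam k : deg_le q (pairing ell lam) ->
  pairing ell lam <= k%:Z -> (msize q <= k.+1)%N.
Proof. by rewrite /deg_le => h hk; rewrite -lez_nat; apply: le_trans h _; lia. Qed.

(** Correct the values level by level: the [p lam] of level [k] vanish at lower levels. The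
    remainder vanishes up to level [d] and is zero by injectivity. *)
Lemma interp_span rho (p : 'rV[int]_n -> {mpoly C[n]}) d q :
  interp_inj rho -> (forall lam, Lambda_plus B lam -> interp_poly rho lam (p lam)) ->
  invariant_poly W q -> (msize q <= d.+1)%N ->
  exists c, q = \sum_(lam <- level d) c lam *: p lam.
Proof.
move=> hinj hp hq sq.
have [c hc] : exists c,
    vanishes_upto rho d.+1 (q - \sum_(lam <- level d) c lam *: p lam).
  suff : forall k, (k <= d.+1)%N ->
    exists c, vanishes_upto rho k (q - \sum_(lam <- level d) c lam *: p lam) by apply.
  elim=> [_|k IH kd].
    exists (fun=> 0) => mu hmu lt; have := ell_Lambda_plus_ge0 hmu; lia.
  have [c hc] := IH (ltnW kd); set r := q - _ in hc.
  exists (fun lam => c lam + (pairing ell lam == k%:Z)%:R * ev r (rho + inV C lam)).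
  move=> mu hmu ltk.
  have -> : q - \sum_(lam <- level d)
      (c lam + (pairing ell lam == k%:Z)%:R * ev r (rho + inV C lam)) *: p lam =
    r - \sum_(lam <- level d)
      ((pairing ell lam == k%:Z)%:R * ev r (rho + inV C lam)) *: p lam.
    rewrite /r -addrA -opprD -big_split; congr (_ - _); apply: eq_bigr => lam _.
    by rewrite scalerDl.
  have muL : mu \in level d by apply/levelP; split=> //; lia.
  rewrite evB ev_sum (bigD1_seq mu) ?level_uniq //= big_seq_cond big1 => [|lam].
    rewrite addr0 evZ; have [_ _ hmm] := hp mu hmu.
    rewrite [ev (p mu) _]hmm // eqxx mulr1.
    case: eqP => [_|ne]; first by rewrite mul1r subrr.
    rewrite mul0r subr0 hc //; lia.
  move=> /andP[/levelP[hl _] ne]; rewrite evZ.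
  case: eqP => [e|_]; last by rewrite !mul0r.
  have [_ _ hlm] := hp lam hl; rewrite [ev (p lam) _]hlm ?(negbTE ne) ?mulr0 //; lia.
exists c; apply/eqP; rewrite -subr_eq0; apply/eqP; apply: (hinj d.+1) => //.
  apply: invariant_polyD => //; apply/invariant_polyN/invariant_poly_sum => lam.
  by move=> /levelP[hl _]; apply: invariant_polyZ; have [] := hp lam hl.
apply: msizeB_leq => //; apply: msize_sum_leq => lam /levelP[hl le] _.
apply: leq_trans (msizeZ_le _ _) _; apply: (@deg_le_msize _ lam _ _ le).
by have [] := hp lam hl.
Qed.

(** Induction on the level: at [rho + lam] the other members of at least the same level vanish, and
    the lower ones have coefficient 0. *)
Lemma interp_free rho (p : 'rV[int]_n -> {mpoly C[n]}) (s : seq 'rV[int]_n) c :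
  (forall lam, Lambda_plus B lam -> interp_poly rho lam (p lam)) -> uniq s ->
  (forall lam, lam \in s -> Lambda_plus B lam) ->
  \sum_(lam <- s) c lam *: p lam = 0 -> forall lam, lam \in s -> c lam = 0.
Proof.
move=> hp us hs e lam.
have [k] := ubnP `|pairing ell lam|%N; elim: k lam => // k IH lam ltk ls.
have := congr1 (fun q => ev q (rho + inV C lam)) e.
rewrite ev0 ev_sum (bigD1_seq lam) //= big_seq_cond big1 => [|mu /andP[ms ne]].
  rewrite addr0 evZ; have [_ _ hl] := hp lam (hs _ ls).
  by rewrite [ev (p lam) _]hl ?eqxx ?mulr1 //; apply: hs.
have [lt|le] := ltP (pairing ell mu) (pairing ell lam).
  have := ell_Lambda_plus_ge0 (hs _ ms) => ge0.
  rewrite (IH mu) ?scale0r ?ev0 //; lia.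
have [_ _ hm] := hp mu (hs _ ms).
by rewrite evZ [ev (p mu) _]hm ?(negbTE ne) ?mulr0 //; apply: hs.
Qed.

(** The difference of the two sides has degree at most [ell lam] and vanishes up to that level:
    there [L p] is zero, as it involves [p] only at strictly lower levels. *)
Lemma interp_eigen rho lam p q : inV0 B W rho -> dominant B Delta rho ->
  interp_inj rho -> Lambda_plus B lam -> interp_poly rho lam p ->
  dl * q = clearedL rho p -> lin C ell * p - q = evalV ell (rho + inV C lam) *: p.
Proof.
move=> hr hd hinj hl [ip dp vp] hq.
have iq : invariant_poly W q.
  have [q' [hq' iq']] := clearedL_dvd rho ip.
  by rewrite (disc_cancel (etrans hq (esym hq'))).
have [k hk] : exists k : nat, pairing ell lam = k%:Z.
  by exists `|pairing ell lam|%N; rewrite gez0_abs // ell_Lambda_plus_ge0.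
have sp : (msize p <= k.+1)%N by apply: (deg_le_msize dp); rewrite hk.
apply/eqP; rewrite -subr_eq0; apply/eqP; apply: (hinj k.+1).
- apply: invariant_polyD; last exact/invariant_polyN/invariant_polyZ.
  apply: invariant_polyD; last exact: invariant_polyN.
    exact: (invariant_polyM invariant_lin_ell ip).
- rewrite evalVD scalerDl opprD addrA; apply: msizeB_leq.
    exact: leq_trans (msize_euler hr hd hq) sp.
  exact: leq_trans (msizeZ_le _ _) sp.
move=> mu hm lt; have le : pairing ell mu <= pairing ell lam by lia.
have q0 : ev q (rho + inV C mu) = 0.
  apply: (clearedL_quot_eq0 hr hd ip hq hm) => eta he hme.
  have := pairingB ell mu eta; rewrite (ell_Lambda1 he) => e1.
  have lt1 : pairing ell (mu - eta) < pairing ell lam.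
    by rewrite e1 (lt_le_trans _ le) // ltrBlDr ltrDl.
  rewrite [ev p _]vp ?ltW //; case: eqP => // e2.
  by rewrite -e2 ltxx in lt1.
rewrite !evB evM evZ q0 subr0 ev_lin [ev p _]vp //.
by case: eqP => [->|_]; rewrite ?mulr1 ?mulr0 subrr.
Qed.

(** (C9) concerns only degrees that occur as levels. Multiples of a dual basis vector of level 1
    realise them all; without such a vector, (C8) for [ell] and 0 forces [n = 0], where polynomials
    are constant. *)
Lemma exists_level d q : (msize q <= d.+1)%N ->
  exists2 lam, Lambda_plus B lam /\ pairing ell lam <= d%:Z &
    ((msize q)%:Z <= pairing ell lam + 1).
Proof.
move=> sq; have [/existsP[i hi]|h] :=
  boolP [exists i, pairing ell (row i (invmx B)) == 1]; last first.
  have n0 (i : 'I_n) : False.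
    have [f hf] := evalV_linear.
    have f0 z : f z = 0.
      have lz : linear_for *%R (fun z : 'rV[C]_n => 0 : C).
        by move=> a y x; rewrite mulr0 addr0.
      pose g : {scalar 'rV[C]_n} := HB.pack (fun z : 'rV[C]_n => 0 : C)
        (GRing.isLinear.Build _ _ _ _ _ lz).
      apply: (hC8 (f := f) (g := g)) => // [w y wW|eta].
        by rewrite !hf /actV /actV_mx -evalV_mul hC4 //; exact: W_inv.
      rewrite !inE => /andP[/Sigma_dualP[j ->] e]; case/negP: h.
      by apply/existsP; exists j.
    have := f0 (inV C (row i (invmx B))); rewrite hf evalV_inV => /eqP.
    by rewrite intr_eq0; have := ell_ge1 i; case: eqP => // ->.
  exists 0; first by split; [exact: Lambda_plus0|rewrite /pairing mul0mx mxE].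
  rewrite /pairing mul0mx mxE add0r lez_nat.
  rewrite msizeE; apply/bigmax_leqP_seq => m _ _; rewrite mdegE big1 //.
exists (row i (invmx B) *+ d).
  have e : pairing ell (row i (invmx B) *+ d) = d%:Z.
    rewrite /pairing -scaler_nat -scalemxAl mxE -/(pairing _ _) (eqP hi) mulr1.
    by rewrite natz.
  split; last by rewrite e.
  elim: d {sq e} => [|d IH]; first by rewrite mulr0n; apply: Lambda_plus0.
  by rewrite mulrS; apply: Lambda_plus_add IH => //; apply: Lambda_plus_row.
rewrite /pairing -scaler_nat -scalemxAl mxE -/(pairing _ _) (eqP hi) mulr1 natz.
by rewrite -PoszD lez_nat addn1.
Qed.

(** Adding a multiple of [q] to the interpolation polynomial [p] of a suitable level keeps its
    values; if the degree is kept as well, uniqueness gives [q = 0]. *)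
Lemma C9_interp_inj rho :
  (forall lam, Lambda_plus B lam -> exists! p : {mpoly C[n]},
     [/\ invariant_poly W p, deg_eq p (pairing ell lam)
       & delta_values B ell rho lam p]) ->
  interp_inj rho.
Proof.
move=> h [|d] q iq sq vq.
  by apply/eqP; rewrite -msize_poly_eq0 -leqn0.
have [lam [hl le] ge] := exists_level sq.
have [p [[ip dp vp] up]] := h lam hl.
have vpq c : delta_values B ell rho lam (p + c *: q).
  move=> mu hm hml; rewrite -/(ev _ _) evD evZ [ev q _]vq ?mulr0 ?addr0 //; last by lia.
  exact: vp.
have ipq c : invariant_poly W (p + c *: q).
  by apply: invariant_polyD => //; apply: invariant_polyZ.
have eq0 c : c != 0 -> deg_eq (p + c *: q) (pairing ell lam) -> q = 0.
  move=> c0 dc; have /eqP := up _ (And3 (ipq c) dc (vpq c)).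
  rewrite -{1}[p]addr0 (inj_eq (addrI p)).
  by rewrite eq_sym scaler_eq0 (negbTE c0) /= => /eqP.
have [k hk] : exists k : nat, pairing ell lam = k%:Z.
  by exists `|pairing ell lam|%N; rewrite gez0_abs // ell_Lambda_plus_ge0.
have sp : msize p = k.+1 by move: dp; rewrite /deg_eq hk -PoszD addn1 => -[].
have sq' : (msize q <= k.+1)%N by move: ge; rewrite hk -PoszD lez_nat addn1.
have le1 c : (msize (p + c *: q) <= k.+1)%N.
  by apply: msizeD_leq; rewrite ?sp // (leq_trans (msizeZ_le _ _)).
(* Uniqueness is among polynomials of exact degree. The degree cannot drop for both multiples 1 and
   2, as [p = 2 (p + q) - (p + 2 q)]. *)
have [e|ne] := eqVneq (msize (p + 1 *: q)) k.+1.
  by apply: (eq0 1); rewrite ?oner_eq0 // /deg_eq e hk -PoszD addn1.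
have lt : (msize (p + 1 *: q) <= k)%N by rewrite -ltnS ltn_neqAle ne le1.
apply: (eq0 2); first by rewrite pnatr_eq0.
rewrite /deg_eq hk -PoszD addn1; congr Posz; apply/eqP; rewrite eqn_leq le1 /= ltnNge.
apply/negP => le2.
have : (msize p <= k)%N.
  have -> : p = 2 *: (p + 1 *: q) - (p + 2 *: q).
    rewrite scale1r scalerDr opprD addrACA subrr addr0.
    by rewrite scaler_nat mulr2n addrK.
  by apply: msizeB_leq le2; apply: leq_trans (msizeZ_le _ _) lt.
by rewrite sp ltnn.
Qed.

(** * Passage from [rho0] to a dominant [rho] *)

Section Transfer.
Variables (rho0 : 'rV[C]_n) (p0 : 'rV[int]_n -> {mpoly C[n]}).
Hypotheses (hr0 : inV0 B W rho0) (hd0 : dominant B Delta rho0).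
Hypotheses (hinj0 : interp_inj rho0).
Hypothesis hp0 : forall lam, Lambda_plus B lam -> interp_poly rho0 lam (p0 lam).
Variable rho : 'rV[C]_n.
Hypotheses (hr : inV0 B W rho) (hd : dominant B Delta rho).

(* On [P^W_(<= d) / P^W_(< d)] the operator [E] acts by the scalar [ell rho + d]: the
   operators [E - ell rho] for two values of [rho] differ by an operator lowering
   the degree, and for [rho0] there is an eigenbasis. *)
Lemma euler_lowers_degree d p q : invariant_poly W p -> (msize p <= d.+1)%N ->
  dl * q = clearedL rho p ->
  (msize (lin C ell * p - q - (evalV ell rho + d%:R) *: p)%R <= d)%N.
Proof.
move=> ip sp hq.
have [c pE] := interp_span hinj0 hp0 ip sp.
have [q0 [hq0 _]] := clearedL_dvd rho0 ip.
have eig : lin C ell * p - q0 =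
    \sum_(lam <- level d) (c lam * evalV ell (rho0 + inV C lam)) *: p0 lam.
  apply: disc_cancel; rewrite mulrBr hq0 {2}pE clearedL_sum {1}pE !big_distrr -sumrB /=.
  rewrite big_seq [RHS]big_seq; apply: eq_bigr => lam /levelP[hl _].
  have [ip' _ _] := hp0 hl; have [q' [hq' _]] := clearedL_dvd rho0 ip'.
  have := interp_eigen hr0 hd0 hinj0 hl (hp0 hl) hq'; rewrite -hq' => /eqP.
  rewrite subr_eq => /eqP; rewrite -!mul_mpolyC mpolyCM => e.
  rewrite [lin C ell * _]mulrCA e; ring.
have low0 : (msize (lin C ell * p - q0 - (evalV ell rho0 + d%:R) *: p)%R <= d)%N.
  rewrite eig pE scaler_sumr -sumrB; apply: msize_sum_leq => lam /levelP[hl le] _.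
  rewrite scalerA -scalerBl evalVD evalV_inV.
  have [_ dp0 _] := hp0 hl.
  have [e|ne] := eqVneq (pairing ell lam) d%:Z.
    rewrite e -pmulrn mulrC subrr scale0r msize0 //.
  apply: leq_trans (msizeZ_le _ _) _.
  by move: dp0; rewrite /deg_le -lez_nat; lia.
have -> : lin C ell * p - q - (evalV ell rho + d%:R) *: p =
   (lin C ell * p - q0 - (evalV ell rho0 + d%:R) *: p) +
   ((lin C ell * p - q - evalV ell rho *: p) -
    (lin C ell * p - q0 - evalV ell rho0 *: p)).
  by rewrite !scalerDl; ring.
apply: msizeD_leq low0 _.
apply: leq_trans (msize_eulerB hr hd hq hr0 hd0 hq0) _.
by move: sp; case: (msize p).
Qed.

Lemma dominant_interp_inj : interp_inj rho.
Proof.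
elim=> [|d IH] p ip sp vp.
  by apply/eqP; rewrite -msize_poly_eq0 -leqn0.
have [q [hq iq]] := clearedL_dvd rho ip.
have vq mu : Lambda_plus B mu ->
    (forall nu, Lambda_plus B nu -> pairing ell nu < pairing ell mu ->
       ev p (rho + inV C nu) = 0) ->
    ev q (rho + inV C mu) = 0.
  move=> hm h; apply: (clearedL_quot_eq0 hr hd ip hq hm) => eta he hme; apply: h => //.
  by rewrite pairingB (ell_Lambda1 he) ltrBlDr ltrDl.
(* This has degree below [d] and vanishes below level [d], so the induction hypothesis applies. *)
have r0 : lin C ell * p - q - (evalV ell rho + d%:R) *: p = 0.
  apply: IH; last 1 first.
  - move=> mu hm lt; rewrite !evB evM evZ (vp mu) //; last by lia.
    rewrite vq //; first by rewrite !mulr0 !subr0.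
    by move=> nu hn ltn; apply: vp => //; lia.
  - apply: invariant_polyD; last exact/invariant_polyN/invariant_polyZ.
    apply: invariant_polyD; last exact: invariant_polyN.
    exact: (invariant_polyM invariant_lin_ell ip).
  exact: euler_lowers_degree.
(* Induction on the level: the eigenvalue equation at [rho + mu] reads
   [(ell(mu) - d) * p(rho + mu) = 0], with nonzero first factor above level [d]. *)
apply: (@lattice_dense rho) => mu hm.
have [k] := ubnP `|pairing ell mu|%N; elim: k mu hm => // k IHk mu hm ltk.
have [lt|le] := ltP (pairing ell mu) d.+1%:Z; first exact: vp.
have q0 : ev q (rho + inV C mu) = 0.
  apply: vq => // nu hn lt; apply: IHk => //.
  by have := ell_Lambda_plus_ge0 hn; lia.
have := congr1 (fun r => ev r (rho + inV C mu)) r0.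
rewrite ev0 !evB evM evZ q0 subr0 ev_lin -mulrBl evalVD evalV_inV => /eqP.
rewrite mulf_eq0 => /orP[|/eqP //]; rewrite opprD addrACA subrr add0r.
rewrite -[d%:R]/(d%:Z%:~R) -intrB intr_eq0 subr_eq0 => /eqP e.
by move: le; rewrite e; lia.
Qed.

(** The values of the [p0] on [rho + level d] form a square matrix. A left kernel vector gives a
    combination of the [p0] that is zero by [dominant_interp_inj], so the vector is zero by
    [interp_free]; the inverse matrix supplies the coefficients. *)
Lemma interp_exists lam : Lambda_plus B lam -> exists q, interp_poly rho lam q.
Proof.
move=> hl.
have [d hd'] : exists k : nat, pairing ell lam = k%:Z.
  by exists `|pairing ell lam|%N; rewrite gez0_abs // ell_Lambda_plus_ge0.
pose L := level d; pose N := size L; pose l (i : 'I_N) := nth 0 L i.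
have lL i : l i \in L by apply: mem_nth.
pose M : 'M[C]_N := \matrix_(i, j) ev (p0 (l i)) (rho + inV C (l j)).
pose comb (v : 'rV[C]_N) := \sum_i v 0 i *: p0 (l i).
have combE v j : ev (comb v) (rho + inV C (l j)) = (v *m M) 0 j.
  by rewrite ev_sum mxE; apply: eq_bigr => i _; rewrite evZ mxE.
have comb_inv v : invariant_poly W (comb v).
  apply: invariant_poly_sum => i _; apply: invariant_polyZ.
  by have /levelP[h _] := lL i; have [] := hp0 h.
have comb_size v : (msize (comb v) <= d.+1)%N.
  apply: msize_sum_leq => i _ _; apply: leq_trans (msizeZ_le _ _) _.
  have /levelP[h le] := lL i; apply: (@deg_le_msize _ (l i) _ _ le).
  by have [] := hp0 h.
have index_level mu : Lambda_plus B mu -> pairing ell mu <= d%:Z -> exists j, mu = l j.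
  move=> hm le; have mL : mu \in L by apply/levelP.
  have lt : (index mu L < N)%N by rewrite index_mem.
  by exists (Ordinal lt); rewrite /l /= nth_index.
have Mu : M \in unitmx.
  rewrite -row_free_unit -kermx_eq0; apply/eqP/row_matrixP => i; rewrite row0.
  set v := row i _.
  have vM : v *m M = 0 by rewrite /v -row_mul mulmx_ker row0.
  have c0 : comb v = 0.
    apply: (dominant_interp_inj (comb_inv v) (comb_size v)) => mu hm lt.
    have [|j ->] := index_level mu hm; first by lia.
    by rewrite combE vM mxE.
  apply/rowP => j; rewrite [RHS]mxE.
  pose c (mu : 'rV[int]_n) := \sum_(k | l k == mu) v 0 k.
  have linj : injective l.
    move=> a b /eqP; rewrite nth_uniq ?level_uniq // => /eqP; exact: val_inj.
  have cl k : c (l k) = v 0 k.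
    by rewrite /c (big_pred1 k) // => k'; rewrite /= (inj_eq linj).
  rewrite -cl; apply: (@interp_free rho0 p0 L c) => //; first exact: level_uniq.
    by move=> mu /levelP[].
  rewrite -[RHS]c0 (big_nth 0) big_mkord; apply: eq_bigr => k _.
  by rewrite -/(l k) cl.
have lamL : lam \in L by apply/levelP; rewrite hd'.
have [j ej] : exists j, lam = l j by apply: index_level; rewrite ?hd'.
exists (comb (delta_mx 0 j *m invmx M)); split=> //.
  by rewrite /deg_le hd' -PoszD addn1 lez_nat.
move=> mu hm le; rewrite hd' in le; have [k ek] := index_level mu hm le.
rewrite ek -/(ev _ _) combE mulmxKV // mxE eqxx /= ej; congr (_%:R).
by rewrite /l nth_uniq ?level_uniq // eq_sym.
Qed.
End Transfer.

(** * The operator on rational functions and the conclusion *)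

Lemma L_opE rho p q : dl * q = clearedL rho p ->
  L_op B W Delta ell rho p = q%:F.
Proof.
move=> hq; have d0 : dl%:F != 0 by rewrite tofrac_eq0 disc_mpoly_neq0.
apply: (mulfI d0); rewrite -tofracM hq /L_op big_distrr /clearedL /cleared_op.
rewrite rmorph_sum /=; apply: eq_bigr => eta _.
rewrite -[f_coef _ _ _ _ _]/
  ((num_poly Ph (kval B W rho) eta)%:F / (den_poly C Delta eta)%:F).
have e := den_cof C Delta_half Delta_plus_tau eta.
have den0 : (den_poly C Delta eta)%:F != 0.
  rewrite tofrac_eq0; apply: contraTneq disc_mpoly_neq0 => d00.
  by rewrite -e d00 mul0r negbK.
rewrite -e !tofracM.
have aux (F : fieldType) (x c m s : F) : x != 0 -> x * c * (m / x * s) = m * c * s.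
  by move=> x0; field.
exact: aux.
Qed.

Lemma theorem_numField (rho : 'rV[C]_n) : axiomC9 C B W Delta ell ->
  inV0 B W rho -> dominant B Delta rho ->
  exists p : 'rV[int]_n -> {mpoly C[n]},
    [/\ forall lam, Lambda_plus B lam ->
          unique (fun q : {mpoly C[n]} =>
                    [/\ invariant_poly W q, deg_le q (pairing ell lam)
                      & delta_values B ell rho lam q])
                 (p lam),
        forall d : nat,
          family_basis (fun lam => Lambda_plus B lam /\ pairing ell lam <= d%:Z)
                       p
                       (fun q => invariant_poly W q /\ deg_le q d%:Z)
      & forall lam, Lambda_plus B lam ->
          E_op B W Delta ell rho (p lam)
          = (evalV ell (rho + inV _ lam) *: p lam)%:F].
Proof.
move=> [rho0 [hr0 _ hd0 h9]] hr hd.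
have hinj0 := C9_interp_inj h9.
have [p0 hp0] : {p0 : 'rV[int]_n -> {mpoly C[n]} &
    forall lam, Lambda_plus B lam -> interp_poly rho0 lam (p0 lam)}.
  apply: (boolp.choice (P := fun lam q =>
    Lambda_plus B lam -> interp_poly rho0 lam q)) => lam.
  (* Outside [Lambda_plus] nothing is asked of the family; its value there is set to 0. *)
  have [hl|hl] := Lambda_plus_dec hB lam; last by exists 0.
  have [q [[iq dq vq] _]] := h9 lam hl; exists q => _.
  by split=> //; rewrite /deg_le dq.
have hinj := dominant_interp_inj hr0 hd0 hinj0 hp0 hr hd.
have [p hp] : {p : 'rV[int]_n -> {mpoly C[n]} &
    forall lam, Lambda_plus B lam -> interp_poly rho lam (p lam)}.
  apply: (boolp.choice (P := fun lam q =>
    Lambda_plus B lam -> interp_poly rho lam q)) => lam.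
  have [hl|hl] := Lambda_plus_dec hB lam; last by exists 0.
  by have [q hq] := interp_exists hr0 hd0 hinj0 hp0 hr hd hl; exists q.
have deg_msize q (d : nat) : deg_le q d%:Z -> (msize q <= d.+1)%N.
  by rewrite /deg_le -PoszD addn1 lez_nat.
have msize_deg q (d : nat) : (msize q <= d.+1)%N -> deg_le q d%:Z.
  by rewrite /deg_le -PoszD addn1 lez_nat.
have ell_nat lam : Lambda_plus B lam -> exists d : nat, pairing ell lam = d%:Z.
  by exists `|pairing ell lam|%N; rewrite gez0_abs // ell_Lambda_plus_ge0.
exists p; split=> [lam hl|d|lam hl].
- split=> [|q [iq dq vq]]; first exact: hp.
  have [ip dp vp] := hp lam hl; have [d ed] := ell_nat lam hl.
  apply/eqP; rewrite -subr_eq0; apply/eqP/(hinj d.+1).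
  + exact/invariant_polyD/invariant_polyN.
  + by rewrite ed in dp dq; apply: msizeB_leq; apply: deg_msize.
  move=> mu hm lt; have le : pairing ell mu <= pairing ell lam by rewrite ed; lia.
  by rewrite evB [ev (p lam) _]vp // [ev q _]vq // subrr.
- split=> [lam [hl le]|s c us hs|q [iq dq]].
  + have [ip dp _] := hp lam hl; split=> //; apply: msize_deg.
    exact: deg_le_msize dp le.
  + by apply: (interp_free hp) => // lam /hs[].
  have [c ->] := interp_span hinj hp iq (deg_msize _ _ dq).
  exists (level d), c; split=> [|lam /levelP //|//]; exact: level_uniq.
have [ip _ _] := hp lam hl; have [q [hq _]] := clearedL_dvd rho ip.
rewrite /E_op (L_opE hq) -tofracB; congr (_%:F).
exact: (interp_eigen hr hd hinj hl (hp lam hl) hq).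
Qed.

End Operator.

End RootData.

Theorem theorem3p6 (R : realType) (n : nat) (B : 'M[int]_n)
    (W : {fset 'M[int]_n}) (ell : 'cV[int]_n) (Delta : {fset 'cV[int]_n})
    (hB : B \in unitmx) (hW : is_group W)
    (hC1 : generated_by_reflections R[i] W)
    (hDelta : primitive_root_system W Delta)
    (hC2 : axiomC2 B Delta)
    (hC3 : axiomC3 B W)
    (hC4 : axiomC4 W ell)
    (hC5 : axiomC5 B W Delta ell)
    (hC6 : axiomC6 B ell)
    (hC7 : axiomC7 B W Delta ell)
    (hC8 : axiomC8 R[i] B W ell)
    (hC9 : axiomC9 R[i] B W Delta ell)
    (rho : 'rV[R[i]]_n) (hrho : inV0 B W rho) (hdom : dominant B Delta rho) :
  exists p : 'rV[int]_n -> {mpoly R[i][n]},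
    [/\ forall lam, Lambda_plus B lam ->
          unique (fun q : {mpoly R[i][n]} =>
                    [/\ invariant_poly W q, deg_le q (pairing ell lam)
                      & delta_values B ell rho lam q])
                 (p lam),
        forall d : nat,
          family_basis (fun lam => Lambda_plus B lam /\ pairing ell lam <= d%:Z)
                       p
                       (fun q => invariant_poly W q /\ deg_le q d%:Z)
      & forall lam, Lambda_plus B lam ->
          E_op B W Delta ell rho (p lam)
          = (evalV ell (rho + inV _ lam) *: p lam)%:F].
Proof.
have [co [hprim hco hst hgen]] := hDelta.
exact: (theorem_numField hB hW hprim hco hst hgen hC2 hC3 hC4 hC5 hC6 hC7 hC8 hC9
  hrho hdom).
Qed.
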